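(* Let $\alpha>0$, let $W$ be a standard Brownian motion, and let $m$ be a locally finite signed measure on $[0,\infty)$ such that $m(\{0\})<\frac1\alpha$, $m([0,x])\leq\frac1\alpha$ for all $x\geq0$, and $\int_{[0,\infty)}e^{-cx^2}\,\mathrm{d}|m|(x)<\infty$ for all $c>0$. Put $v(x)=m([0,x])$ for $x\geq0$. Then for a function $\ell\in C([0,\infty))$ the following are equivalent: (a) $\ell_t=\int_0^\infty\mathbb{P}(\tau_x\leq t)\,v(x)\,\mathrm{d}x$ for all $t\geq0$, where $\tau_x=\inf\{t>0:x+W_t-\alpha\ell_t\leq0\}$ for $x\geq0$; (b) $\ell_t=\int_{[0,\infty)}\mathbb{E}[L^x_t]\,\mathrm{d}m(x)$ for all $t\geq0$, where $(X^x,L^x)$ solves the Skorokhod problem for $x+W-\alpha\ell$ for $x\geq0$.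
   Context: **Signed measure.** A signed measure $m$ is of the form $m=m_+-m_-$ with measures $m_+,m_-$, at least one of which is finite; $|m|$ denotes its variation. **Skorokhod problem.** For a càdlàg function $f:[0,\infty)\to\mathbb{R}$ with $f_0\geq0$, a pair $(x,z)$ of càdlàg functions solves the Skorokhod problem for $f$ if $z$ is nondecreasing with $z_0=0$, $x_t = f_t+z_t\geq0$ and $\int_0^t \mathbf{1}_{\{x_s>0\}}\,\mathrm{d}z_s=0$ for all $t\geq0$. The unique solution is $z_t=\sup_{0\leq s\leq t}(f_s)_-$, $x=f+z$, where $(y)_-=\max(-y,0)$. For processes it is solved pathwise; in (b) it is part of the condition that $x-\alpha\ell_0\geq0$ for all $x\geq0$. *)

(* Defs.v *)
From HB Require Import structures.
From mathcomp Require Import all_boot all_order all_algebra.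
From mathcomp Require Import all_classical all_reals all_analysis.

Set Implicit Arguments.
Unset Strict Implicit.
Unset Printing Implicit Defensive.

Import Order.TTheory GRing.Theory Num.Theory.
Import numFieldNormedType.Exports.

Local Open Scope classical_set_scope.
Local Open Scope ring_scope.

(* The library's charges are finite-valued, whereas a signed measure may take
   one of the values +oo, -oo.  It is represented by its Jordan decomposition:
   by the Jordan decomposition theorem, every difference of two measures, one of
   which is finite, is the difference of exactly one such pair that is moreover
   mutually singular, and its variation is the sum of that pair. *)
Record signed_measure d (T : measurableType d) (R : realType) := SignedMeasure {
  smeas_pos : {measure set T -> \bar R};
  smeas_neg : {measure set T -> \bar R};
  smeas_finite : (smeas_pos setT < +oo)%E \/ (smeas_neg setT < +oo)%E;
  smeas_singular : exists N : set T,
    [/\ measurable N, smeas_pos N = 0%E & smeas_neg (~` N) = 0%E] }.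

Definition smeas d (T : measurableType d) (R : realType)
    (m : signed_measure T R) (A : set T) : \bar R :=
  (smeas_pos m A - smeas_neg m A)%E.

Coercion smeas : signed_measure >-> Funclass.

Definition smeas_variation d (T : measurableType d) (R : realType)
    (m : signed_measure T R) : {measure set T -> \bar R} :=
  measure_add (smeas_pos m) (smeas_neg m).

Definition smeas_integral d (T : measurableType d) (R : realType)
    (m : signed_measure T R) (D : set T) (g : T -> \bar R) : \bar R :=
  (\int[smeas_pos m]_(x in D) g x - \int[smeas_neg m]_(x in D) g x)%E.

(* Functions and processes indexed by [0, +oo[ are functions on R whose values
   at negative times are irrelevant; a signed measure on [0, +oo[ is one on R
   that does not charge the negative half-line. *)
Definition on_half_line (R : realType) (m : signed_measure R R) : Prop :=
  smeas_variation m `]-oo, 0[%classic = 0%E.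

Definition locally_finite_half_line (R : realType) (m : signed_measure R R)
    : Prop :=
  forall x : R, 0 <= x -> (smeas_variation m `[0%R, x]%classic < +oo)%E.

Definition cadlag (R : realType) (f : R -> R) : Prop :=
  (forall t : R, 0 <= t -> f s @[s --> t^'+] --> f t) /\
  (forall t : R, 0 < t -> cvg (f s @[s --> t^'-])).

(* In [skorokhod_complementarity], dz is the Lebesgue-Stieltjes measure of z
   extended to negative times by the constant z 0; such an F exists as soon as
   z is nondecreasing and right-continuous on [0, +oo[, and it is unique. *)
Record skorokhod_problem (R : realType) (f x z : R -> R) : Prop := {
  skorokhod_data_cadlag : cadlag f;
  skorokhod_data_ge0 : 0 <= f 0;
  skorokhod_x_cadlag : cadlag x;
  skorokhod_z_cadlag : cadlag z;
  skorokhod_z_nondecreasing : forall s t : R, 0 <= s -> s <= t -> z s <= z t;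
  skorokhod_z0 : z 0 = 0;
  skorokhod_decomposition : forall t : R, 0 <= t -> x t = f t + z t;
  skorokhod_x_ge0 : forall t : R, 0 <= t -> 0 <= x t;
  skorokhod_complementarity : exists2 F : cumulative R R,
    (forall t : R, F t = z (Num.max t 0)) &
    (forall t : R, 0 <= t ->
      (\int[lebesgue_stieltjes_measure F]_(s in `[0%R, t])
        (\1_[set u : R | (0 < x u)%R] s)%:E = 0)%E) }.

(* Some of the sets B i may be setT, so the product rule for the full family
   contains the product rule for every subfamily. *)
Definition mutually_independent d (T : measurableType d) (R : realType)
    (P : probability T R) (n : nat) (Y : 'I_n -> T -> R) : Prop :=
  forall B : 'I_n -> set R, (forall i, measurable (B i)) ->
    P (\bigcap_(i in [set: 'I_n]) (Y i @^-1` B i)) =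
    (\prod_(i < n) P (Y i @^-1` B i))%E.

(* [normal_prob] takes the mean and the standard deviation. *)
Record standard_brownian_motion d (T : measurableType d) (R : realType)
    (P : probability T R) (W : R -> T -> R) : Prop := {
  brownian_measurable : forall t : R, 0 <= t -> measurable_fun setT (W t);
  brownian_continuous : forall w, {within `[0, +oo[, continuous (W ^~ w)};
  brownian_start : forall w, W 0 w = 0;
  brownian_gaussian : forall s t : R, 0 <= s -> s < t ->
    forall B : set R, measurable B ->
      P ((fun w => W t w - W s w) @^-1` B) = normal_prob 0 (Num.sqrt (t - s)) B;
  brownian_independent : forall (n : nat) (t : nat -> R),
    0 <= t 0 -> (forall i, (i < n)%N -> t i < t i.+1) ->
    mutually_independent P (fun (i : 'I_n) w => W (t i.+1) w - W (t i) w) }.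

(* Equal to +oo when Y stays positive, the infimum being taken in \bar R. *)
Definition hitting_time (R : realType) (Y : R -> R) : \bar R :=
  ereal_inf [set t%:E | t in [set t : R | 0 < t /\ Y t <= 0]].

(* Main.v *)
(* Write M_t = sup_{s <= t} (alpha l_s - W_s).  Pathwise, the Skorokhod problem
   for x + W - alpha l is solved by L^x_t = (M_t - x)_+, and {tau_x <= t} lies
   between {M_t > x} and {M_t >= x}, events of the same probability for all but
   countably many x.  Hence E[L^x_t] is the integral of P(tau_y <= t) over
   y >= x, and Tonelli's theorem, applied to both parts of m, turns the
   right-hand side of (b) into that of (a).

   The two parts may be subtracted because the positive part of m is finite (if
   the negative one is, then m([0,x]) <= 1/alpha bounds the positive one) and
   E[(M_t)_+] is finite.  The latter is obtained by chaining over dyadic times,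
   which uses only the fourth moments of the increments of W.

   The condition l_0 <= 0 implicit in (b) follows from (a) at t = 0: if l_0 > 0,
   then l_0 is the integral of v over [0, alpha l_0), which is strictly smaller
   than l_0 since v <= 1/alpha, v(0) < 1/alpha and v is right-continuous. *)
Require Import Defs.
From HB Require Import structures.
From mathcomp Require Import all_boot all_order all_algebra.
From mathcomp Require Import all_classical all_reals all_analysis.
From mathcomp Require Import measurable_realfun.
From mathcomp Require Import lra ring.

Set Implicit Arguments.
Unset Strict Implicit.
Unset Printing Implicit Defensive.

Import Order.TTheory GRing.Theory Num.Theory.
Import numFieldNormedType.Exports.

Local Open Scope classical_set_scope.
Local Open Scope ring_scope.

(** * Running maximum of a continuous function *)

(** The map [s |-> max s 0] is continuous with values in the half-line. Extending by the value at 0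
    replaces continuity within [[0, +oo[] by continuity on all of [R], which the lemmas below
    assume. *)
Lemma continuous_comp_max0 (R : realType) (f : R -> R) :
  {within `[0, +oo[, continuous f} -> continuous (fun s : R => f (Num.max s 0)).
Proof.
move=> cf x A fA; set h : R := Num.max x 0.
have h0 : (`[0, +oo[%classic : set R) h by rewrite /= in_itv/= andbT le_max
  lexx orbT.
have := cf h A fA; rewrite /= /nbhs /= -nbhs_subspace_in// => wA.
have mx : (fun s : R => Num.max s 0) @ x --> h.
  by apply: continuous_max; [exact: cvg_id|exact: cvg_cst].
have := mx _ wA; rewrite /within.
apply: (@filterS _ (nbhs x)) => y /=; apply.
by rewrite /= in_itv/= andbT le_max lexx orbT.
Qed.

(* The supremum of the empty set being 0, so is [runmax g t] for [t < 0]. *)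
Definition runmax (R : realType) (g : R -> R) (t : R) : R :=
  sup [set g s | s in `[0, t]].

Lemma runmax_attained (R : realType) (g : R -> R) (t : R) :
  continuous g -> 0 <= t ->
  exists2 s, 0 <= s <= t & runmax g t = g s /\
    (forall u, 0 <= u <= t -> g u <= g s).
Proof.
move=> cg t0.
have [c c0t gc] := EVT_max t0 (continuous_subspaceT cg).
exists c; first by move: c0t; rewrite in_itv.
split; last by move=> u u0t; apply: gc; rewrite in_itv.
apply/eqP; rewrite eq_le; apply/andP; split.
  apply: ge_sup; first by exists (g c); exists c.
  by move=> _ [s s0t <-]; exact: gc.
apply: ub_le_sup; last by exists c.
by exists (g c) => _ [s s0t <-]; exact: gc.
Qed.

Lemma runmax_ge (R : realType) (g : R -> R) (t s : R) :
  continuous g -> 0 <= s <= t -> g s <= runmax g t.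
Proof.
move=> cg /andP[s0 st].
have [u _ [-> h]] := runmax_attained cg (le_trans s0 st).
by apply: h; rewrite s0.
Qed.

Lemma runmax_le (R : realType) (g : R -> R) (t c : R) :
  continuous g -> 0 <= t -> (forall s, 0 <= s <= t -> g s <= c) ->
  runmax g t <= c.
Proof. by move=> cg t0 h; have [u /h gu [-> _]] := runmax_attained cg t0. Qed.

Lemma le_runmax (R : realType) (g : R -> R) (s t : R) :
  continuous g -> 0 <= s -> s <= t -> runmax g s <= runmax g t.
Proof.
move=> cg s0 st; apply: runmax_le => // u /andP[u0 us].
by apply: runmax_ge => //; rewrite u0 (le_trans us).
Qed.

Lemma runmax0 (R : realType) (g : R -> R) : runmax g 0 = g 0.
Proof. by rewrite /runmax set_itv1 image_set1 sup1. Qed.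

Lemma continuous_runmax (R : realType) (g : R -> R) :
  continuous g -> continuous (fun t : R => runmax g (Num.max t 0)).
Proof.
move=> cg t; pose h (s : R) : R := Num.max s 0.
have h0 s : 0 <= h s by rewrite /h le_max lexx orbT.
have hh s u : s <= u -> h s <= h u.
  by move=> su; rewrite /h le_max2.
have cg0 : continuous (g \o h).
  by apply: (@continuous_comp_max0 _ g); exact: continuous_subspaceT.
apply/cvgrPdist_le => e e0.
have e20 : 0 < e / 2 by rewrite divr_gt0.
have : nbhs t [set u | `|g (h t) - g (h u)| <= e / 2].
  by have /cvgrPdist_le/(_ _ e20) := cg0 t.
move=> /nbhs_ballP[r /= r0 hr].
(* A maximiser beyond [h u] lies within [r] of [t]; there [g] and [g (h u)] are both within [e / 2]
   of [g (h t)], so the maximum grows by at most [e] from [h u] to [h v]. *)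
have key u v : `|t - u| < r -> `|t - v| < r -> u <= v ->
    runmax g (h v) - runmax g (h u) <= e.
  move=> tu tv uv.
  rewrite lerBlDr; apply: runmax_le => // s /andP[s0 sv].
  have [su|us] := leP s (h u).
    have : g s <= runmax g (h u) by apply: runmax_ge => //; rewrite s0.
    by lra.
  have hs : h s = s by rewrite /h max_l.
  have us' : u < s.
    by apply: le_lt_trans us; rewrite /h le_max lexx.
  have sv' : s <= v.
    move: sv; rewrite /h le_max => /orP[//|s0'].
    by move: us; rewrite ltNge (le_trans s0').
  have ts : `|t - s| < r.
    move: tu tv; rewrite !ltr_norml => /andP[? ?] /andP[? ?].
    by apply/andP; split; lra.
  have := hr _ ts; have := hr _ tu; rewrite /= hs.
  rewrite !ler_norml => /andP[? ?] /andP[? ?].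
  have : g (h u) <= runmax g (h u) by apply: runmax_ge => //; rewrite h0 lexx.
  by lra.
have tt : `|t - t| < r by rewrite subrr normr0.
apply/nbhs_ballP; exists r => //= u tu.
rewrite ler_norml.
have [ut|tu'] := leP u t.
  have := key _ _ tu tt ut; have := le_runmax cg (h0 u) (hh _ _ ut).
  by rewrite -/(h u) -/(h t); move=> ? ?; apply/andP; split; lra.
have := key _ _ tt tu (ltW tu'); have := le_runmax cg (h0 t) (hh _ _ (ltW tu')).
by rewrite -/(h u) -/(h t); move=> ? ?; apply/andP; split; lra.
Qed.

(** * The Skorokhod problem with a continuous datum *)

Lemma lebesgue_stieltjes_measure_oc (R : realType) (F : cumulative R R)
    (a b : R) : a <= b ->
  lebesgue_stieltjes_measure F `]a, b] = (F b - F a)%:E.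
Proof.
move=> ab; rewrite /lebesgue_stieltjes_measure /measure_extension.
by rewrite measurable_mu_extE/=; [rewrite wlength_itv_bnd | exact: is_ocitv].
Qed.

Lemma cadlag_continuous (R : realType) (f h : R -> R) :
  continuous h -> (forall t, 0 <= t -> f t = h t) -> cadlag f.
Proof.
move=> ch fh; split=> t t0.
  rewrite fh//; apply: cvg_trans (cvg_at_right_filter (ch t)).
  apply: near_eq_cvg; near=> s; apply/esym/fh; apply: (le_trans t0).
  by apply/ltW; near: s; exact: nbhs_right_gt.
apply/cvg_ex; exists (h t).
apply: cvg_trans (cvg_at_left_filter (ch t)).
by apply: near_eq_cvg; near=> s; apply/esym/fh; near: s; exact: nbhs_left_ge.
Unshelve. all: by end_near. Qed.

(** Existence by the explicit formula. For complementarity, [z] is constant near every point where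
    the reflected path is positive, so these points are covered by countably many half-open rational
    intervals on which [z] does not increase, and each of them is null for [dz]. *)
Lemma skorokhod_continuous (R : realType) (f g : R -> R) (x : R) :
  continuous g -> g 0 <= x -> (forall t, 0 <= t -> f t = x - g t) ->
  let z (t : R) : R := Num.max (runmax g (Num.max t 0) - x) 0 in
  skorokhod_problem f (fun t : R => x - g (Num.max t 0) + z t) z.
Proof.
move=> cg gx fg z.
have cg0 : continuous (fun t : R => g (Num.max t 0)).
  by apply: continuous_comp_max0; exact: continuous_subspaceT.
have cz : continuous z.
  move=> t; apply: (@continuous_max _ _ (fun t : R => runmax g (Num.max t 0) -
    x) (fun=> 0)).
    apply: cvgB; [exact: continuous_runmax|exact: cvg_cst].
  exact: cvg_cst.
have cX : continuous (fun t : R => x - g (Num.max t 0) + z t).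
  by move=> t; apply: cvgD; [apply: cvgB;
    [exact: cvg_cst|exact: cg0]|exact: cz].
have h0 (t : R) : 0 <= t -> Num.max t 0 = t by move=> t0; rewrite max_l.
have zD : {homo z : s t / s <= t}.
  move=> s t st; rewrite /z le_max2// lerB//.
  by apply: le_runmax => //; [rewrite le_max lexx orbT|exact: le_max2].
have zrc : right_continuous z by exact: right_continuousW.
have X0 (t : R) : 0 <= t -> 0 <= x - g (Num.max t 0) + z t.
  move=> t0; have : g t <= runmax g t by apply: runmax_ge => //;
    rewrite t0 lexx.
  have : runmax g (Num.max t 0) - x <= z t by rewrite /z le_max lexx.
  by rewrite h0//; lra.
split.
- by apply: (@cadlag_continuous _ _ (fun t => x - g (Num.max t 0))) => [t|t t0];
    [apply: cvgB; [exact: cvg_cst|exact: cg0]|rewrite h0// fg].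
- by rewrite fg// subr_ge0.
- exact: cadlag_continuous cX _.
- exact: cadlag_continuous cz _.
- by move=> s t _; exact: zD.
- by rewrite /z h0// runmax0 max_r// subr_le0.
- by move=> t t0; rewrite h0// fg.
- exact: X0.
pose F : cumulative R R := HB.pack z (isCumulative.Build R _ R z zD zrc).
exists F => [t|t t0];
  first by rewrite /F/= /z (h0 (Num.max t 0))// le_max lexx orbT.
set mu := lebesgue_stieltjes_measure F.
(* Enumerates the rational intervals on which [z] is flat; every other code yields the empty set. *)
pose A n : set R := if unpickle n is Some pq then
  let p := ratr pq.1 : R in let q := ratr pq.2 : R in
  if (p <= q) && (z p == z q) then `]p, q]%classic else set0 else set0.
have A0 k : mu.-negligible (A k).
  rewrite /A; case: (unpickle k : option (rat * rat)) => [[p q]|] /=;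
    last exact: negligible_set0.
  case: ifPn => [/andP[pq /eqP zpq]|_]; last exact: negligible_set0.
  apply/negligibleP; first exact: measurable_itv.
  by apply: etrans (lebesgue_stieltjes_measure_oc F pq) _; rewrite /= zpq subrr.
set X := fun t : R => x - g (Num.max t 0) + z t in cX X0 *.
have mA : measurable [set u | 0 < X u].
  apply: open_measurable; rewrite (_ : mkset _ = X @^-1` `]0, +oo[%classic).
    by apply: open_comp => // ? _; exact: cX.
  by apply/seteqP; split => u /=; rewrite in_itv/= andbT.
have : mu.-negligible ([set u | 0 < X u] `&` `[0, t]).
  apply: negligibleS (negligible_bigcup A0) => s /= [Xs].
  rewrite in_itv/= => /andP[s0 st].
  have /nbhs_ballP[r /= r0 hr] : nbhs s [set u | 0 < X u].
    exact: (cX s _ (lt_nbhsr Xs)).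
  have [p] := @rat_in_itvoo _ (s - r) s (ltac:(by rewrite ltrBlDr ltrDl)).
  rewrite in_itv/= => /andP[ps1 ps2].
  have [q] := @rat_in_itvoo _ s (s + r) (ltac:(by rewrite ltrDl)).
  rewrite in_itv/= => /andP[qs1 qs2].
  exists (pickle (p, q)); first exact: I.
  rewrite /A pickleK /=.
  have pq : (ratr p : R) <= ratr q by lra.
  rewrite pq /=; case: ifPn => [_|/negP]; first by rewrite /= in_itv/= ps2 ltW.
  apply; rewrite eq_le zD//=.
  have q0 : 0 <= (ratr q : R) by lra.
  have [c /andP[c0 cq] [rq _]] := runmax_attained cg q0.
  rewrite {1}/z h0// rq ge_max; apply/andP; split;
    last by rewrite /z le_max lexx orbT.
  (* Here [c] maximises [g] on [[0, q]]. If [c] does not exceed [max p 0], the maximum is already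
     reached by then. Otherwise [X c > 0], that is [g c - x < z c <= z q], which rules out
     [z q = g c - x] and leaves [g c - x <= 0]. *)
  have [cp|pc] := leP c (Num.max (ratr p) 0).
    rewrite /z le_max; apply/orP; left.
    by rewrite lerB//; apply: runmax_ge => //; rewrite c0.
  have sc : `|s - c| < r.
    move: pc; rewrite gt_max => /andP[pc _].
    by rewrite ltr_norml; apply/andP; split; lra.
  have := hr _ sc; rewrite /= /X h0//.
  have := zD _ _ cq; rewrite {2}/z h0// rq.
  case: (leP (g c - x) 0) => [gc|_]; last by lra.
  by move=> _ _; apply: le_trans gc _; rewrite /z le_max lexx orbT.
move/negligibleP => /(_ (measurableI _ _ mA (measurable_itv _))) muA.
by rewrite integral_indic//; exact: muA.
Unshelve. all: by end_near. Qed.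

(** Nonnegativity of [X] and monotonicity of [z] give the lower bound on [z t]. If the bound were
    strict, [z] would have to pass a level [a] strictly between the two values, which
    complementarity forbids. *)
Lemma skorokhod_unique (R : realType) (f g X z : R -> R) (x : R) :
  continuous g -> (forall t, 0 <= t -> f t = x - g t) ->
  skorokhod_problem f X z ->
  forall t, 0 <= t -> z t = Num.max (runmax g t - x) 0.
Proof.
move=> cg fg [_ _ _ _ zD z0 Xfz X0 [F Fz cF]] t t0.
set B := Num.max _ _.
have B0 : 0 <= B by rewrite /B le_max lexx orbT.
have Fz' s : 0 <= s -> F s = z s by move=> s0; rewrite Fz max_l.
have FD := cumulative_is_nondecreasing F.
apply/eqP; rewrite eq_le; apply/andP; split; last first.
  rewrite ge_max; apply/andP; split; last by rewrite -z0 zD.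
  rewrite lerBlDr; apply: runmax_le => // s /andP[s0 st].
  have := X0 _ s0; rewrite Xfz// fg//; have := zD _ _ s0 st; lra.
rewrite leNgt; apply/negP => Bz.
pose a := (B + z t) / 2.
have Ba : B < a by rewrite /a; lra.
have az : a < z t by rewrite /a; lra.
(* The infimum [u] of [S] is the first passage of [F] to the level [a]. Since [F] vanishes at
   negative times and [a > 0], the set is bounded below by 0. *)
pose S := [set s | s <= t /\ a <= F s].
have St : S t by split; [exact: lexx|rewrite Fz'//; exact: ltW].
have S_ge0 s : S s -> 0 <= s.
  move=> [_ as_]; rewrite leNgt; apply/negP => s0.
  by move: as_; rewrite Fz max_r ?(ltW s0)// z0; lra.
have lbS : has_lbound S by exists 0.
pose u := inf S.
have u0 : 0 <= u by apply: lb_le_inf => //; exists t.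
have ut : u <= t by exact: ge_inf.
have Sgt s : u < s -> s <= t -> a <= F s.
  move=> us st; have [r [rt ar] rs] := inf_lt (ex_intro _ _ St) us.
  by apply: le_trans ar _; apply: FD; exact: ltW.
have Fu : a <= F u.
  move: ut; rewrite le_eqVlt => /predU1P[->|ut]; first by rewrite Fz'// ltW.
  apply: (cvgr_to_ge (cumulative_is_right_continuous F u)).
  near=> s; apply: Sgt; near: s; [exact: nbhs_right_gt|exact: nbhs_right_le].
  
have Flt s : s < u -> F s < a.
  move=> su; rewrite ltNge; apply/negP => aF.
  suff : u <= s by rewrite leNgt su.
  by apply: ge_inf => //; rewrite /S /=; split => //; lra.
pose mu : {measure set _ -> \bar R} := lebesgue_stieltjes_measure F.
(* Once z exceeds the level a, f + z is positive, so that dz does not charge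
   [u, t]; but z increases by at least z t - a > 0 on ]u - 1/n, t]. *)
have mu0 : mu `[u, t]%classic = 0%E.
  have cF0 := cF t t0.
  pose Y s := x - g (Num.max s 0) + F s.
  have mY : measurable_fun setT Y.
    apply: measurable_funD.
      apply: continuous_measurable_fun => s.
      apply: cvgB; first exact: cvg_cst.
      by apply: continuous_comp_max0; exact: continuous_subspaceT.
    by apply: nondecreasing_measurable => //; exact: FD.
  have mA : measurable [set s | 0 < Y s].
    have := measurable_fun_ltr (measurable_cst (0:R)) mY.
    by move=> /(_ measurableT [set true]); rewrite setTI; exact.
  have : mu ([set s | 0 < Y s] `&` `[0, t]) = 0%E.
    rewrite -integral_indic// -[RHS]cF0.
    apply: eq_integral => s; rewrite inE/= in_itv/= => /andP[s0 st].
    congr EFin; rewrite !indicE; congr ((_ : bool)%:R).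
    by apply/idP/idP; rewrite !inE/= Xfz// fg// /Y max_l// Fz'.
  move=> muA; apply/eqP; rewrite -measure_le0 -muA.
  apply: (le_measure mu); [| |].
  - by apply: mem_set; exact: measurable_itv.
  - by apply: mem_set; apply: measurableI mA _; exact: measurable_itv.
  move=> s /=; rewrite in_itv/= => /andP[us st].
  have s0 : 0 <= s by lra.
  split; last by rewrite /= in_itv/= s0.
  rewrite /Y max_l//.
  have : g s - x <= B.
    rewrite /B le_max; apply/orP; left.
    by rewrite lerB//; apply: runmax_ge => //; rewrite s0.
  have : F u <= F s by exact: FD.
  by lra.
(* The measure of such an interval is an increment of [F], and [F < a] strictly before [u]; starting
   to the left of [u] also captures a possible jump of [F] at [u]. *)
pose I n : set R := `]u - n.+1%:R^-1, t]%classic.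
have In : \bigcap_n I n = `[u, t]%classic.
  apply/seteqP; split => s /=.
    move=> h; rewrite in_itv/=; apply/andP; split; last first.
      by have := h 0%N Logic.I; rewrite /I/= in_itv/= => /andP[].
    apply/ler_addgt0Pr => e e0.
    have [n ne] := @ltr_add_invr _ 0 e e0.
    have us : u - n.+1%:R^-1 < s.
      by have := h n Logic.I; rewrite /I/= in_itv/= => /andP[].
    by move: ne us; rewrite add0r; set e' := _^-1; lra.
  rewrite in_itv/= => /andP[us st] n _; rewrite /I/= in_itv/= st andbT.
  by apply: lt_le_trans us; rewrite ltrBlDr ltrDl.
have muI n : mu (I n) = (F t - F (u - n.+1%:R^-1))%:E.
  apply: lebesgue_stieltjes_measure_oc.
  by apply: le_trans ut; rewrite lerBlDr lerDl.
have : mu (I n) @[n --> \oo] --> mu (\bigcap_n I n).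
  apply: nonincreasing_cvg_mu.
  - by rewrite muI ltry.
  - by move=> n; exact: measurable_itv.
  - by rewrite In; exact: measurable_itv.
  - move=> m n mn; apply/subsetPset => s;
    rewrite /I/= !in_itv/= => /andP[us ->].
    by rewrite andbT; apply: le_lt_trans us;
      rewrite lerB// lef_pV2 ?posrE// ler_nat.
rewrite In mu0 => cvgI.
have : ((z t - a)%:E <= 0)%E.
  apply: (cvge_to_ge cvgI).
  near=> n; rewrite muI lee_fin Fz'//.
  have := @Flt (u - n.+1%:R^-1);
    rewrite ltrBlDr ltrDl invr_gt0 ltr0n => /(_ isT).
  lra.
by rewrite lee_fin; lra.
Unshelve. all: by end_near. Qed.

(** * Hitting times *)

(** The maximiser [c] may be 0, whereas only positive times count for [hitting_time]. As [g > y]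
    persists near [c], the times [c + d] with small [d > 0] serve instead. *)
Lemma hitting_time_le_runmax (R : realType) (g Y : R -> R) (y t : R) :
  continuous g -> (forall s, 0 <= s -> Y s = y - g s) -> 0 <= t ->
  y < runmax g t -> (hitting_time Y <= t%:E)%E.
Proof.
move=> cg Yg t0; have [c /andP[c0 ct] [-> _]] := runmax_attained cg t0 => yc.
have /nbhs_ballP[r /= r0 hr] : nbhs c [set u | y < g u].
  exact: (cg c _ (lt_nbhsr yc)).
apply/lee_addgt0Pr => e e0.
pose d := Num.min (r / 2) e.
have d0 : 0 < d by rewrite lt_min e0 divr_gt0.
have [dr de] : d <= r / 2 /\ d <= e by rewrite /d !ge_min !lexx orbT.
apply: (@le_trans _ _ (c + d)%:E); last first.
  by rewrite -EFinD lee_fin; lra.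
apply: ereal_inf_lbound; exists (c + d) => //=; split; first by lra.
have : y < g (c + d).
  by apply: hr; rewrite /ball/= opprD addrA subrr add0r normrN gtr0_norm//; lra.
by rewrite Yg; lra.
Qed.

(** If the running maximum at [t] is below [y], it stays below [y] for a short while after [t] by
    continuity, so the hitting time is at least [t + r / 2]. *)
Lemma runmax_hitting_time_le (R : realType) (g Y : R -> R) (y t : R) :
  continuous g -> (forall s, 0 <= s -> Y s = y - g s) -> 0 <= t ->
  (hitting_time Y <= t%:E)%E -> y <= runmax g t.
Proof.
move=> cg Yg t0 ht; rewrite leNgt; apply/negP => gy.
have := @continuous_runmax _ _ cg t; rewrite /continuous_at max_l// => ct.
have /nbhs_ballP[r /= r0 hr] : nbhs t [set u | runmax g (Num.max u 0) < y].
  exact: (ct _ (lt_nbhsl gy)).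
have : ((t + r / 2)%:E <= t%:E)%E.
  apply: le_trans ht; apply/ereal_infP => r' [s /= [s0]].
  rewrite Yg ?(ltW s0)// => ys <-; rewrite lee_fin leNgt; apply/negP => st.
  have : runmax g (Num.max (t + r / 2) 0) < y.
    apply: hr; rewrite /ball/= opprD addrA subrr add0r normrN gtr0_norm; lra.
  rewrite max_l; last by lra.
  have : g s <= runmax g (t + r / 2) by apply: runmax_ge => //; rewrite !ltW.
  by lra.
by rewrite lee_fin; lra.
Qed.

(* The infimum over the positive times need not be attained at a positive time,
   so the event is expressed through maxima over the compact intervals
   [b n k, a n] instead. *)
Lemma hitting_time_leP (R : realType) (g Y : R -> R) (y t : R) :
  continuous g -> (forall s, 0 <= s -> Y s = y - g s) -> 0 <= t ->
  let a (n : nat) : R := t + n.+1%:R^-1 in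
  let b (n k : nat) : R := a n / k.+1%:R in
  (hitting_time Y <= t%:E)%E <->
  forall n, exists k, y <= runmax (fun s => g (s + b n k)) (a n - b n k).
Proof.
move=> cg Yg t0 a b.
have a0 n : 0 < a n by rewrite ltr_wpDl// invr_gt0.
have b0 n k : 0 < b n k by rewrite divr_gt0.
have ba n k : b n k <= a n.
  by rewrite ler_pdivrMr// ler_peMr ?(ltW (a0 n))// ler1n.
have cgb c : continuous (fun s => g (s + c)).
  move=> s; apply: (@cvg_comp _ _ _ (fun s => s + c) g); last exact: cg.
  by apply: cvgD; [exact: cvg_id|exact: cvg_cst].
split=> [ht n|h].
  have : (hitting_time Y < (a n)%:E)%E.
    by apply: le_lt_trans ht _; rewrite lte_fin ltrDl invr_gt0.
  move=> /ereal_inf_lt[r' [s /= [s0]]]; rewrite Yg ?(ltW s0)// => ys <-.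
  rewrite lte_fin => sa.
  have [k] := @ltr_add_invr _ 0 (s / a n) (divr_gt0 s0 (a0 n)).
  rewrite add0r ltr_pdivlMr// => ks; exists k.
  have bs : b n k < s by rewrite /b mulrC.
  apply: (@le_trans _ _ (g (s - b n k + b n k))); first by rewrite subrK; lra.
  apply: (@runmax_ge _ (fun s => g (s + b n k))) => //.
  by rewrite subr_ge0 (ltW bs) lerB// ltW.
apply/lee_addgt0Pr => e e0.
have [n] := @ltr_add_invr _ 0 e e0; rewrite add0r => ne.
have [k] := h n; have bn0 : 0 <= a n - b n k by rewrite subr_ge0.
have [s /andP[s0 sa] [-> _]] := runmax_attained (cgb (b n k)) bn0 => ys.
apply: (@le_trans _ _ (s + b n k)%:E).
  apply: ereal_inf_lbound; exists (s + b n k) => //=.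
  have sb0 := ltr_wpDl s0 (b0 n k); split => //.
  by rewrite Yg ?subr_le0// ltW.
rewrite -EFinD lee_fin; apply: (@le_trans _ _ (a n)); first by rewrite -lerBrDr.
by rewrite lerD2l ltW.
Qed.

(** By continuity the maximum exceeds [c] as soon as the value at some time [t * q] does, with [q]
    rational in [[0, 1]]. Rescaling to the unit interval includes the degenerate case [t = 0]. *)
Lemma measurable_runmax d (T : measurableType d) (R : realType)
    (G : R -> T -> R) (t : R) :
  (forall s, 0 <= s -> measurable_fun setT (G s)) ->
  (forall w, continuous (G ^~ w)) -> 0 <= t ->
  measurable_fun setT (fun w => runmax (G ^~ w) t).
Proof.
move=> mG cG t0.
apply: (measurability _ (RGenOInfty.measurableE R)) => /= _ [_ [c ->] <-].
rewrite setTI.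
pose A (q : rat) := if 0 <= (ratr q : R) <= 1
  then G (t * ratr q) @^-1` `]c, +oo[%classic else set0.
rewrite (_ : _ @^-1` _ = \bigcup_q A q).
  apply: bigcupT_measurable_rat => q; rewrite /A; case: ifPn => // /andP[q0 q1].
  rewrite -[_ @^-1` _]setTI; apply: mG => //.
  by rewrite mulr_ge0.
apply/seteqP; split => w /=.
  rewrite in_itv/= andbT.
  have [s /andP[s0 st] [-> _]] := runmax_attained (cG w) t0 => cs.
  have [u [u0 u1 su]] : exists u, [/\ 0 <= u, u <= 1 & s = t * u].
    move: t0; rewrite le_eqVlt => /predU1P[t0|t0].
      by exists 0; split => //; rewrite mulr0; lra.
    exists (s / t); split;
      [exact: divr_ge0 (ltW t0)|by rewrite ler_pdivrMr ?mul1r|].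
    by rewrite mulrC divfK// gt_eqF.
  have cGt : continuous (fun u => G (t * u) w).
    move=> v; apply: (@cvg_comp _ _ _ (fun u => t * u) (G ^~ w));
      last exact: cG.
    by apply: cvgM; [exact: cvg_cst|exact: cvg_id].
  rewrite su in cs.
  have /nbhs_ballP[r /= r0 hr] : nbhs u [set v | c < G (t * v) w].
    exact: (cGt u _ (lt_nbhsr cs)).
  have : Num.max (u - r) 0 < Num.min (u + r) 1.
    by rewrite gt_max !lt_min; apply/andP; split; apply/andP; split; lra.
  move=> /rat_in_itvoo[q]; rewrite in_itv/= gt_max lt_min.
  move=> /andP[/andP[q1 q2] /andP[q3 q4]].
  exists q => //; rewrite /A !ltW//= in_itv/= andbT.
  by apply: hr; rewrite /ball/= ltr_norml; apply/andP; split; lra.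
move=> [q _]; rewrite /A; case: ifPn => // /andP[q0 q1] /=.
rewrite !in_itv/= !andbT => cq; apply: lt_le_trans cq _.
apply: (@runmax_ge _ (G ^~ w)) => //.
by rewrite mulr_ge0//= ler_piMr.
Qed.

Lemma measurable_hitting_time_le d (T : measurableType d) (R : realType)
    (G Y : R -> T -> R) (y t : R) :
  (forall s, 0 <= s -> measurable_fun setT (G s)) ->
  (forall w, continuous (G ^~ w)) ->
  (forall s w, 0 <= s -> Y s w = y - G s w) -> 0 <= t ->
  measurable [set w | (hitting_time (Y ^~ w) <= t%:E)%E].
Proof.
move=> mG cG YG t0.
pose a (n : nat) : R := t + n.+1%:R^-1.
pose b (n k : nat) : R := a n / k.+1%:R.
have a0 n : 0 < a n by rewrite ltr_wpDl// invr_gt0.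
have b0 n k : 0 < b n k by rewrite divr_gt0.
have ba n k : b n k <= a n.
  by rewrite ler_pdivrMr// ler_peMr ?(ltW (a0 n))// ler1n.
rewrite (_ : mkset _ = \bigcap_n \bigcup_k
    [set w | y <= runmax (fun s => G (s + b n k) w) (a n - b n k)]).
  apply: bigcapT_measurable => n; apply: bigcupT_measurable => k.
  have mM : measurable_fun setT
      (fun w => runmax (fun s => G (s + b n k) w) (a n - b n k)).
    apply: (@measurable_runmax _ _ _ (fun s => G (s + b n k))).
    - by move=> s s0; apply: mG; rewrite addr_ge0// ltW.
    - move=> w s; apply: (@cvg_comp _ _ _ (fun s => s + b n k) (G ^~ w));
      last exact: cG.
      by apply: cvgD; [exact: cvg_id|exact: cvg_cst].
    - by rewrite subr_ge0.
  have := measurable_fun_ler (measurable_cst y) mM.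
  by move=> /(_ measurableT [set true]); rewrite setTI; exact.
apply/seteqP; split => w /=.
  move=> /(hitting_time_leP (cG w) (fun s => YG s w) t0) h n _.
  by have [k hk] := h n; exists k.
move=> h; apply/(hitting_time_leP (cG w) (fun s => YG s w) t0) => n.
by have [k _ hk] := h n I; exists k.
Qed.

(** * Integrability of the running maximum of Brownian motion *)

(** A dyadic point of level [n + 1] has an even index and belongs to level [n], or an odd one and
    lies one increment of level [n + 1] after a point of level [n]. Hence each level adds at most
    one increment. *)
Lemma dyadic_chaining (R : realType) (w : R -> R) (t : R) (U : nat -> R) :
  let p (n k : nat) : R := k%:R / 2 ^+ n * t in
  w 0 = 0 -> (forall n, 0 <= U n) ->
  (forall n k, (k < 2 ^ n)%N -> `|w (p n k.+1) - w (p n k)| <= U n) ->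
  forall n k, (k <= 2 ^ n)%N -> `|w (p n k)| <= \sum_(j < n.+1) U j.
Proof.
move=> p w0 U0 wU; elim=> [|n IH] k kn.
  rewrite big_ord_recr big_ord0 /= add0r.
  case: k kn => [|[|//]] _; first by rewrite /p !mul0r w0 normr0.
  by have := wU 0%N 0%N isT; rewrite {2}/p !mul0r w0 subr0.
rewrite big_ord_recr /=.
have pD k' : p n.+1 k'.*2 = p n k'.
  rewrite /p -muln2 natrM exprS; field.
  by rewrite expf_neq0.
rewrite -(odd_double_half k) in kn *; case: (odd k) kn => /=;
  rewrite ?add0n => kn.
  have k2 : (k./2 < 2 ^ n)%N.
    by move: kn; rewrite add1n expnS mul2n ltn_double.
  have := wU n.+1 k./2.*2; rewrite add1n in kn *; move=> /(_ kn).
  rewrite pD => h.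
  rewrite -[w _](subrK (w (p n k./2))) addrC.
  apply: le_trans (ler_normD _ _) _; apply: lerD => //.
  by apply: IH; exact: ltnW.
rewrite pD (le_trans (IH _ _))//; last by rewrite lerDl.
by move: kn; rewrite expnS mul2n leq_double.
Qed.

Lemma chaining_bound (R : realType) (w : R -> R) (t : R) (U : nat -> R) :
  continuous w -> 0 <= t -> w 0 = 0 -> (forall n, 0 <= U n) ->
  (forall n k, (k < 2 ^ n)%N ->
    `|w (k.+1%:R / 2 ^+ n * t) - w (k%:R / 2 ^+ n * t)| <= U n) ->
  forall s, 0 <= s <= t -> (`|w s|%:E <= \sum_(j <oo) (U j)%:E)%E.
Proof.
move=> cw t0 w0 U0 wU s /andP[s0 st].
have nS : (0 <= \sum_(j <oo) (U j)%:E)%E.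
  by apply: nneseries_ge0 => n _ _; exact: U0.
move: t0; rewrite le_eqVlt => /predU1P[t0|t0].
  by rewrite (_ : s = 0) ?w0 ?normr0//; apply/eqP; rewrite eq_le s0 t0 st.
apply/lee_addgt0Pr => e e0.
have : nbhs s [set u | `|w s - w u| <= e].
  by have /cvgrPdist_le/(_ _ e0) := cw s.
move=> /nbhs_ballP[r /= r0 hr].
have [n tn] : exists n : nat, t / 2 ^+ n < r.
  have [n] := @ltr_add_invr _ 0 (r / t) (divr_gt0 r0 t0).
  rewrite add0r ltr_pdivlMr// => nr; exists n.
  apply: le_lt_trans nr;
    rewrite mulrC ler_wpM2r ?(ltW t0)// lef_pV2 ?posrE ?exprn_gt0//.
  by rewrite -natrX ler_nat ltn_expl.
have n2 : (0 : R) < 2 ^+ n by rewrite exprn_gt0.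
pose x := s / t * 2 ^+ n.
have x0 : 0 <= x by rewrite mulr_ge0 ?divr_ge0// ltW.
(* [k / 2 ^ n * t] is the last dyadic point of level [n] not after [s]; it is closer to [s] than
   [r]. *)
pose k := Num.trunc x.
have /andP[kx xk] : k%:R <= x < k.+1%:R by exact: truncn_itv.
have xs : x / 2 ^+ n * t = s by rewrite /x mulfK ?gt_eqF// divfK// gt_eqF.
have k2 : (k <= 2 ^ n)%N.
  rewrite -(ler_nat R) natrX (le_trans kx)// /x ler_piMl ?(ltW n2)//.
  by rewrite ler_pdivrMr// mul1r.
have sk : `|s - k%:R / 2 ^+ n * t| < r.
  rewrite -xs -mulrBl -mulrBl ger0_norm; last first.
    by rewrite !mulr_ge0 ?invr_ge0 ?subr_ge0// ltW.
  apply: le_lt_trans tn; rewrite -mulrA [leRHS]mulrC ler_piMl//.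
    by rewrite mulr_ge0 ?invr_ge0// ltW.
  by rewrite lerBlDr nat1r ltW.
apply: (@le_trans _ _ ((\sum_(j < n.+1) U j) + e)%:E).
  rewrite lee_fin -[w s](subrK (w (k%:R / 2 ^+ n * t))) addrC.
  apply: le_trans (ler_normD _ _) _; apply: lerD; last exact: (hr _ sk).
  exact: (dyadic_chaining w0 U0 wU).
rewrite EFinD leeD2r//.
rewrite -sumEFin -(big_mkord xpredT (fun j => (U j)%:E)).
by apply: nneseries_lim_ge => j _ _; rewrite lee_fin.
Qed.

(* Lets a sum of fourth powers bound a maximum of increments linearly, without
   taking fourth roots of expectations. *)
Lemma le_dist_power4 (R : realType) (a x : R) : 0 < a ->
  `|x| <= a + x ^+ 4 / a ^+ 3.
Proof.
move=> a0; have a3 : 0 < a ^+ 3 by rewrite exprn_gt0.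
have x4 : x ^+ 4 = `|x| ^+ 4 by rewrite -normrX ger0_norm// exprn_even_ge0.
have [xa|ax] := leP `|x| a.
  by apply: le_trans xa _; rewrite lerDl x4 divr_ge0 ?exprn_ge0// ltW.
apply: (@le_trans _ _ (x ^+ 4 / a ^+ 3)); last by rewrite lerDr ltW.
rewrite ler_pdivlMr// x4 (exprS _ 3) ler_wpM2l//.
by rewrite lerXn2r ?nnegrE ?(ltW a0)// ltW.
Qed.

(** The Radon-Nikodym derivative of [normal_prob] and [normal_pdf] have the same integral over every
    measurable set, hence agree almost everywhere. *)
Lemma ge0_integral_normal_prob (R : realType) (m s : R) (f : R -> \bar R) :
  measurable_fun setT f -> (forall x, (0 <= f x)%E) ->
  (\int[normal_prob m s]_x f x =
   \int[lebesgue_measure]_x (f x * (normal_pdf m s x)%:E))%E.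
Proof.
move=> mf f0; have dom := normal_prob_dominates m s.
rewrite -(Radon_Nikodym_SigmaFinite.change_of_variables dom f0 measurableT mf).
have mpdf : measurable_fun setT (fun x => (normal_pdf m s x)%:E).
  by apply/measurable_EFinP; exact: measurable_normal_pdf.
have iRN := Radon_Nikodym_SigmaFinite.f_integrable dom.
apply: ae_eq_integral => //.
- by apply: emeasurable_funM => //; exact: measurable_int iRN.
- exact: emeasurable_funM.
- apply: ae_eqe_mul2l; apply: integral_ae_eq => //.
  by move=> E _ mE; rewrite -Radon_Nikodym_SigmaFinite.f_integral.
Qed.

(** The integrand is bounded by a multiple of the normal density with standard deviation
    [q = sqrt 2 * s], which integrates to 1. With [u = x ^ 2 / (4 * s ^ 2)] the two exponentials are
    [exp (- 2 * u)] and [exp (- u)], and [x ^ 4 = 16 * s ^ 4 * u ^ 2]; the bounds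
    [u ^ 2 * exp (- u) <= 4] and [sqrt 2 <= 2] give [128 = 16 * 2 * 4]. *)
Lemma normal_moment4 (R : realType) (s : R) : 0 < s ->
  (\int[normal_prob 0 s]_x (x ^+ 4)%:E <= (128 * s ^+ 4)%:E)%E.
Proof.
move=> s0.
have m4 : measurable_fun setT (fun x : R => (x ^+ 4)%:E).
  by apply/measurable_EFinP; exact: measurable_funX.
rewrite ge0_integral_normal_prob//; last first.
  by move=> x; rewrite lee_fin exprn_even_ge0.
pose q := Num.sqrt 2 * s.
have sq2 : Num.sqrt 2 ^+ 2 = 2 :> R by rewrite sqr_sqrtr.
have q20 : 0 < Num.sqrt 2 :> R by rewrite sqrtr_gt0.
have q0 : 0 < q by rewrite mulr_gt0.
have key x : x ^+ 4 * normal_pdf 0 s x <= 128 * s ^+ 4 * normal_pdf 0 q x.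
  rewrite !normal_pdfE ?gt_eqF//.
  have peakq : normal_peak s = Num.sqrt 2 * normal_peak q.
    rewrite /normal_peak (_ : q ^+ 2 * pi *+ 2 = 2 * (s ^+ 2 * pi *+ 2)).
      by rewrite [in RHS]sqrtrM// invfM mulVKf// gt_eqF.
    by rewrite /q exprMn sq2; ring.
  have pq0 : 0 < normal_peak q by rewrite normal_peak_gt0// gt_eqF.
  pose u := x ^+ 2 / (4 * s ^+ 2).
  have u0 : 0 <= u by rewrite divr_ge0 ?sqr_ge0// mulr_ge0// sqr_ge0.
  have s2 : s != 0 by rewrite gt_eqF.
  have fq : normal_fun 0 q x = expR (- u).
    by rewrite /normal_fun subr0 /q exprMn sq2 /u; congr expR; field.
  have fs : normal_fun 0 s x = expR (- u) * expR (- u).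
    by rewrite -expRD /normal_fun subr0 /u; congr expR; field.
  have x4 : x ^+ 4 = 16 * s ^+ 4 * u ^+ 2 by rewrite /u; field.
  have uexp : u ^+ 2 * expR (- u) <= 4.
    rewrite expRN ler_pdivrMr ?expR_gt0//.
    have -> : expR u = expR (u / 2) ^+ 2.
      by rewrite expr2 -expRD; congr expR; lra.
    have := @expR_ge1Dx _ (u / 2); set e := expR _ => ue.
    have : (u / 2) ^+ 2 <= e ^+ 2.
      by apply: lerXn2r; rewrite ?nnegrE; lra.
    by rewrite expr_div_n; lra.
  have sqrt2 : Num.sqrt 2 <= 2 :> R by have := sq2; nra.
  rewrite peakq fq fs x4.
  have -> : 16 * s ^+ 4 * u ^+ 2 * (Num.sqrt 2 * normal_peak q * (expR (- u) *
    expR (- u)))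
    = (16 * s ^+ 4) * (Num.sqrt 2 * (u ^+ 2 * expR (- u))) * (normal_peak q *
      expR (- u)).
    by ring.
  apply: ler_wpM2r; first by rewrite mulr_ge0 ?expR_ge0// ltW.
  have -> : 128 * s ^+ 4 = (16 * s ^+ 4) * (2 * 4) by ring.
  apply: ler_wpM2l; first by rewrite mulr_ge0// exprn_ge0// ltW.
  apply: ler_pM => //.
  by rewrite mulr_ge0 ?expR_ge0 ?sqr_ge0.
have mq : measurable_fun setT (fun x => (normal_pdf 0 q x)%:E).
  by apply/measurable_EFinP; exact: measurable_normal_pdf.
apply: (@le_trans _ _
  (\int[lebesgue_measure]_x ((128 * s ^+ 4)%:E * (normal_pdf 0 q x)%:E))%E).
  apply: ge0_le_integral => //.
  - by move=> x _; rewrite -EFinM lee_fin mulr_ge0 ?normal_pdf_ge0//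
    exprn_even_ge0.
  - apply: emeasurable_funM => //.
    by apply/measurable_EFinP; exact: measurable_normal_pdf.
  - exact: emeasurable_funM.
  - by move=> x _; rewrite -!EFinM lee_fin key.
rewrite ge0_integralZl//; last first.
- by rewrite lee_fin mulr_ge0// exprn_ge0// ltW.
- by move=> x _; rewrite lee_fin normal_pdf_ge0.
by rewrite integral_normal_pdf mule1.
Qed.

Lemma brownian_moment4 (R : realType) d (T : measurableType d)
    (P : probability T R) (W : R -> T -> R) (s t : R) :
  standard_brownian_motion P W -> 0 <= s -> s < t ->
  (\int[P]_w ((W t w - W s w) ^+ 4)%:E <= (128 * (t - s) ^+ 2)%:E)%E.
Proof.
move=> BM s0 st.
have mD : measurable_fun setT (fun w => W t w - W s w).
  apply: measurable_funB; apply: (brownian_measurable BM) => //.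
  by rewrite (le_trans s0)// ltW.
have m4 : measurable_fun setT (fun x : R => (x ^+ 4)%:E).
  by apply/measurable_EFinP; exact: measurable_funX.
have ts0 : 0 < t - s by rewrite subr_gt0.
have -> : (128 * (t - s) ^+ 2) = 128 * Num.sqrt (t - s) ^+ 4.
  by rewrite -[in LHS](sqr_sqrtr (ltW ts0)) -exprM.
apply: le_trans (normal_moment4 (_ : 0 < Num.sqrt (t - s)));
  last by rewrite sqrtr_gt0.
rewrite le_eqVlt; apply/orP; left; apply/eqP.
transitivity (\int[pushforward P ((fun w => (W t w - W s w)%R) : T ->
  measurableTypeR R)]_x (x ^+ 4)%:E)%E.
  rewrite ge0_integral_pushforward//.
  by move=> x _; rewrite lee_fin exprn_even_ge0.
apply: eq_measure_integral => A mA _.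
exact: (brownian_gaussian BM s0 st).
Qed.

Lemma nneseries_geometric_lty (R : realType) (C : R) : 0 <= C ->
  (\sum_(n <oo) (C * (9 / 10) ^+ n)%:E < +oo)%E.
Proof.
move=> C0; apply: (@le_lt_trans _ _ (C * 10)%:E); last exact: ltry.
apply: lime_le.
  by apply: is_cvg_nneseries => n _ _; rewrite lee_fin mulr_ge0 ?exprn_ge0.
apply: nearW => N; rewrite sumEFin lee_fin -mulr_sumr ler_wpM2l//.
have : \sum_(0 <= n < N) (9 / 10 : R) ^+ n + 10 * (9 / 10) ^+ N = 10.
  elim: N => [|N IH]; first by rewrite big_geq// add0r expr0 mulr1.
  by rewrite big_nat_recr//= -[RHS]IH exprS; field.
have : 0 <= (9 / 10 : R) ^+ N by rewrite exprn_ge0.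
lra.
Qed.

(** [U n] bounds every increment of level [n], by [le_dist_power4] at [a = r ^ n] with the fourth
    powers of all increments of that level summed. Its expectation is at most [r ^ n + 128 * t ^ 2 /
    (r ^ (3 * n) * 2 ^ n)], which is summable, and [chaining_bound] shows that the sum of the [U n]
    dominates the path. *)
Lemma brownian_dominated (R : realType) d (T : measurableType d)
    (P : probability T R) (W : R -> T -> R) (t : R) :
  standard_brownian_motion P W -> 0 <= t ->
  exists S : T -> \bar R, [/\ measurable_fun setT S, forall w, (0 <= S w)%E,
    forall w s, 0 <= s <= t -> (`|W s w|%:E <= S w)%E &
    (\int[P]_w S w < +oo)%E].
Proof.
move=> BM t0; pose r : R := 9 / 10.
have r0 : 0 < r by rewrite divr_gt0.
pose p n k : R := k%:R / 2 ^+ n * t.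
have p0 n k : 0 <= p n k by rewrite mulr_ge0 ?divr_ge0 ?exprn_ge0.
pose D n k w := W (p n k.+1) w - W (p n k) w.
have mD4 n k : measurable_fun setT (fun w => (D n k w ^+ 4)%:E).
  apply/measurable_EFinP; apply: measurable_funX.
  by apply: measurable_funB; exact: (brownian_measurable BM).
have D40 n k w : (0 <= (D n k w ^+ 4)%:E)%E by rewrite lee_fin exprn_even_ge0.
pose V n w := (\sum_(k < 2 ^ n) (D n k w ^+ 4)%:E)%E.
have mV n : measurable_fun setT (V n) by exact: emeasurable_sum.
have V0 n w : (0 <= V n w)%E by exact: sume_ge0.
have VE n w : V n w = (\sum_(k < 2 ^ n) D n k w ^+ 4)%:E by rewrite /V sumEFin.
pose c n : R := (r ^+ n) ^- 3.
have c0 n : 0 <= c n by rewrite invr_ge0 !exprn_ge0// ltW.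
pose U n w := ((r ^+ n)%:E + (c n)%:E * V n w)%E.
have U0 n w : (0 <= U n w)%E.
  by rewrite adde_ge0 ?mule_ge0 ?lee_fin ?exprn_ge0 ?(ltW r0).
have mU n : measurable_fun setT (U n).
  by apply: emeasurable_funD => //; exact: measurable_funeM.
exists (fun w => \sum_(n <oo) U n w)%E; split.
- exact: ge0_emeasurable_sum.
- by move=> w; exact: nneseries_ge0.
- move=> w s st.
  have cW : continuous (fun s : R => W (Num.max s 0) w).
    by apply: (@continuous_comp_max0 _ (W ^~ w));
      exact: (brownian_continuous BM).
  pose u n := fine (U n w).
  have uE n : U n w = (u n)%:E by rewrite /u /U VE.
  under eq_eseriesr do rewrite uE.
  have := @chaining_bound _ (fun s : R => W (Num.max s 0) w) t u cW t0.
  rewrite maxxx (brownian_start BM) => /(_ erefl).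
  have u0 n : 0 <= u n by rewrite fine_ge0.
  move=> /(_ u0) => h.
  have {}h := h _ s st; move: h; rewrite max_l; last by case/andP: st.
  apply => n k kn; rewrite !max_l ?p0//.
  apply: le_trans (le_dist_power4 _ (exprn_gt0 n r0)) _.
  rewrite -lee_fin -uE /U EFinD leeD2l// VE -EFinM lee_fin mulrC.
  apply: ler_wpM2l; first exact: c0.
  rewrite (bigD1 (Ordinal kn))//= lerDl.
  by apply: sumr_ge0 => i _; rewrite exprn_even_ge0.
- rewrite integral_nneseries//.
  apply: le_lt_trans (@nneseries_geometric_lty _ (1 + 128 * t ^+ 2) _);
    last first.
    by rewrite addr_ge0// mulr_ge0// sqr_ge0.
  apply: lee_nneseries => [n _ _|n _]; first exact: integral_ge0.
  rewrite ge0_integralD//; last 3 first.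
  - by move=> w _; rewrite lee_fin exprn_ge0// ltW.
  - by move=> w _; rewrite mule_ge0 ?lee_fin ?c0.
  - exact: measurable_funeM.
  rewrite integral_cst//= probability_setT mule1 ge0_integralZl//; last first.
    by rewrite lee_fin.
  rewrite ge0_integral_sum//.
  have Dle k : (\int[P]_w (D n k w ^+ 4)%:E <= (128 * (t / 2 ^+ n) ^+ 2)%:E)%E.
    (* For [t = 0] the dyadic times coincide and the Gaussian law, stated for distinct times, does
       not apply; the increments are then 0. *)
    have [t00|tn0] := eqVneq t 0.
      rewrite integral0_eq; first by rewrite lee_fin mulr_ge0// sqr_ge0.
      by move=> w _; rewrite /D /p t00 !mulr0 subrr expr0n.
    have pS : p n k.+1 - p n k = t / 2 ^+ n.
      by rewrite /p -!mulrBl -natr1 addrC addKr mul1r mulrC.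
    have pp : p n k < p n k.+1.
      by rewrite -subr_gt0 pS divr_gt0 ?exprn_gt0// lt_neqAle eq_sym tn0.
    by rewrite -pS; exact: (brownian_moment4 BM (p0 _ _) pp).
  apply: (@le_trans _ _ ((r ^+ n)%:E +
      (c n)%:E * (\sum_(k < 2 ^ n) (128 * (t / 2 ^+ n) ^+ 2)%:E))%E).
    by rewrite leeD2l// lee_wpmul2l ?lee_fin//; apply: lee_sum.
  rewrite sumEFin -EFinM -EFinD lee_fin sumr_const card_ord -[X in _ *
    X]mulr_natr natrX.
  rewrite [leRHS]mulrDl mul1r -/r lerD2l /c.
  (* This is where [r = 9 / 10] comes from: [r < 1] makes the series converge, and [2 * r ^ 4 >= 1]
     makes the moment term at most a multiple of [r ^ n]. *)
  have ab : 1 <= (r ^+ n) ^+ 4 * 2 ^+ n.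
    rewrite exprAC -exprMn exprn_ege1// /r; lra.
  have a0 : 0 < r ^+ n by rewrite exprn_gt0.
  have b0 : (0 : R) < 2 ^+ n by rewrite exprn_gt0.
  move: a0 b0 ab; set a := r ^+ n; set b := 2 ^+ n => a0 b0 ab.
  rewrite mulrC ler_pdivrMr ?exprn_gt0//.
  have -> : 128 * (t / b) ^+ 2 * b = 128 * t ^+ 2 * b^-1 by field;
    rewrite gt_eqF.
  rewrite -[leRHS]mulrA; apply: ler_wpM2l; first by rewrite mulr_ge0 ?sqr_ge0.
  by rewrite -exprS -div1r ler_pdivrMr.
Qed.

(** * Tail integrals *)

(** Both sides integrate [g y] over the triangle [0 <= x <= y], in the two orders. *)
Lemma tonelli_tail (R : realType) (mu : {measure set R -> \bar R})
    (g : R -> \bar R) :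
  sigma_finite setT mu ->
  measurable_fun (setT : set (measurableTypeR R)) g -> (forall y, (0 <= g y)%E)
    ->
  (\int[mu]_(x in `[0%R, +oo[) \int[lebesgue_measure]_(y in `[x, +oo[) g y =
   \int[lebesgue_measure]_(y in `[0%R, +oo[) (g y * mu `[0%R, y]%classic))%E.
Proof.
move=> sfmu mg g0; pose GR := measurableTypeR R.
pose mu' : {sigma_finite_measure set R -> \bar R} :=
  HB.pack (Measure.sort mu) (isSFinite.Build _ _ _ _
    (sfinite_measure_sigma_finite sfmu)) (isSigmaFinite.Build _ _ _ _ sfmu).
pose A : set (R * GR) := [set p | 0 <= p.1 <= p.2].
have mA : measurable A.
  pose f1 (p : R * GR) := 0 <= p.1; pose f2 (p : R * GR) := p.1 <= p.2.
  rewrite (_ : A = f1 @^-1` [set true] `&` f2 @^-1` [set true]); last first.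
    by apply/seteqP; split => p /=; rewrite /A /f1 /f2 /= => /andP.
  apply: measurableI.
  - have : measurable_fun setT f1 by exact: measurable_fun_ler.
    by move=> /(_ measurableT [set true]); rewrite setTI; exact.
  - have : measurable_fun setT f2 by exact: measurable_fun_ler.
    by move=> /(_ measurableT [set true]); rewrite setTI; exact.
pose f (p : R * GR) := (g p.2 * (\1_A p)%:E)%E.
have mf : measurable_fun setT f.
  apply: emeasurable_funM; first exact: measurableT_comp.
  by apply/measurable_EFinP; exact: measurable_indic.
have f0 p : (0 <= f p)%E by rewrite mule_ge0.
transitivity (\int[mu']_x \int[lebesgue_measure]_y f (x, y))%E.
  rewrite [LHS]integral_mkcond; apply: eq_integral => x _.
  rewrite patchE mem_setE in_itv/= andbT; case: ifPn => [x0|x0]; last first.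
    rewrite integral0_eq// => y _.
    by rewrite /f indicE memNset ?mule0//= /A/= (negbTE x0).
  rewrite integral_mkcond; apply: eq_integral => y _.
  rewrite patchE mem_setE in_itv/= andbT /f indicE/=.
  by case: ifPn => xy; [rewrite mem_set ?mule1|rewrite memNset ?mule0];
    rewrite /A/= ?x0 ?xy ?(negbTE xy).
rewrite (fubini_tonelli f)//= [RHS]integral_mkcond; apply: eq_integral => y _.
rewrite patchE mem_setE in_itv/= andbT; case: ifPn => [y0|y0]; last first.
  rewrite integral0_eq// => x _; rewrite /f indicE memNset ?mule0//= /A/=.
  by move=> /andP[x0 /(le_trans x0)]; rewrite (negbTE y0).
have fE : (fun x : R => f (x, y)) = (fun x : R => g y * (\1_`[0, y] x)%:E)%E.
  apply/funext => x; rewrite /f /= !indicE; congr (_ * (_ : bool)%:R%:E)%E.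
rewrite fE ge0_integralZl//.
  by rewrite integral_indic// setIT.
by apply/measurable_EFinP; exact: measurable_indic.
Qed.

(** The excess of [M w] over [x] is the Lebesgue measure of [[x, M w[]; exchange the two
    integrals. *)
Lemma expectation_excess (R : realType) d (T : measurableType d)
    (P : probability T R) (M : T -> R) (x : R) :
  measurable_fun setT M ->
  (\int[P]_w (Num.max (M w - x) 0)%:E =
   \int[lebesgue_measure]_(y in `[x, +oo[) P (M @^-1` `]y, +oo[))%E.
Proof.
move=> mM; pose GR := measurableTypeR R.
pose A : set (T * GR) := [set p | x <= p.2 < M p.1].
have mA : measurable A.
  pose f1 (p : T * GR) := x <= p.2; pose f2 (p : T * GR) := p.2 < M p.1.
  rewrite (_ : A = f1 @^-1` [set true] `&` f2 @^-1` [set true]); last first.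
    by apply/seteqP; split => p /=; rewrite /A /f1 /f2 /= => /andP.
  apply: measurableI.
  - have : measurable_fun setT f1 by exact: measurable_fun_ler.
    by move=> /(_ measurableT [set true]); rewrite setTI; exact.
  - have : measurable_fun setT f2.
      by apply: measurable_fun_ltr => //; exact: measurableT_comp.
    by move=> /(_ measurableT [set true]); rewrite setTI; exact.
pose f (p : T * GR) : \bar R := (\1_A p)%:E.
have mf : measurable_fun setT f.
  by apply/measurable_EFinP; exact: measurable_indic.
have f0 p : (0 <= f p)%E by rewrite lee_fin.
transitivity (\int[P]_w \int[lebesgue_measure]_y f (w, y))%E.
  apply: eq_integral => w _.
  have -> : (fun y : GR => f (w, y)) = (fun y => (\1_(`[x, M w[%classic : set
    GR) y)%:E).
    by apply/funext => y; rewrite /f !indicE.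
  rewrite integral_indic//= setIT lebesgue_measure_itv/= lte_fin.
  by case: ltP => xM; rewrite ?EFinN -?EFinB; congr EFin; [rewrite max_l//;
    lra|rewrite max_r//; lra].
rewrite (fubini_tonelli f)//= [RHS]integral_mkcond; apply: eq_integral => y _.
rewrite patchE mem_setE in_itv/= andbT; case: ifPn => [xy|xy]; last first.
  by rewrite integral0_eq// => w _;
    rewrite /f indicE memNset//= /A/= (negbTE xy).
have -> : (fun w => f (w, y)) = (fun w => (\1_(M @^-1` `]y, +oo[) w)%:E).
  apply/funext => w; rewrite /f !indicE; congr ((_ : bool)%:R%:E).
  by apply/idP/idP; rewrite !inE /A/= in_itv/= xy andbT.
rewrite integral_indic//= ?setIT//.
by rewrite -[_ @^-1` _]setTI; exact: mM.
Qed.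

(* Unlike in [integralB], the integral of [g] may be infinite. *)
Lemma ge0_integralB (R : realType) d (T : measurableType d)
    (mu : {measure set T -> \bar R}) (D : set T) (f g : T -> \bar R) :
  measurable D -> measurable_fun D f -> measurable_fun D g ->
  (forall x, D x -> (0 <= f x)%E) -> (forall x, D x -> (0 <= g x)%E) ->
  (forall x, D x -> f x \is a fin_num) -> (forall x, D x -> g x \is a fin_num)
    ->
  (\int[mu]_(x in D) f x < +oo)%E ->
  (\int[mu]_(x in D) (f x - g x) =
   \int[mu]_(x in D) f x - \int[mu]_(x in D) g x)%E.
Proof.
move=> mD mf mg f0 g0 ff fg fioo.
pose h x : \bar R := (f x - g x)%E.
have mh : measurable_fun D h by exact: emeasurable_funB.
rewrite -[LHS]/(\int[mu]_(x in D) h x)%E integralE.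
have mhp : measurable_fun D (h^\+)%E by exact: measurable_funepos.
have mhn : measurable_fun D (h^\-)%E by exact: measurable_funeneg.
have key x : D x -> (h^\+ x + g x = h^\- x + f x)%E.
  move=> Dx; rewrite funeposE funenegE /h -(fineK (ff _ Dx)) -(fineK (fg _ Dx)).
  rewrite -EFinB -EFinN -!EFin_max -!EFinD; congr EFin.
  by rewrite /Num.max; case: ltP => ?; case: ltP => ?; lra.
have : (\int[mu]_(x in D) h^\+ x + \int[mu]_(x in D) g x =
        \int[mu]_(x in D) h^\- x + \int[mu]_(x in D) f x)%E.
  rewrite -!ge0_integralD//; apply: eq_integral => x; rewrite inE => Dx.
  exact: key.
have hpf : (\int[mu]_(x in D) h^\+ x <= \int[mu]_(x in D) f x)%E.
  apply: ge0_le_integral => // x Dx; rewrite funeposE ge_max f0// andbT.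
  by rewrite /h leeBlDr ?fg// leeDl// g0.
have := integral_ge0 mu f0; have := integral_ge0 mu g0.
have : (0 <= \int[mu]_(x in D) h^\+ x)%E by exact: integral_ge0.
have : (0 <= \int[mu]_(x in D) h^\- x)%E by exact: integral_ge0.
move: hpf fioo.
set p := (\int[mu]_(x in D) h^\+ x)%E; set n := (\int[mu]_(x in D) h^\- x)%E.
set F := (\int[mu]_(x in D) f x)%E; set G := (\int[mu]_(x in D) g x)%E.
move: p n F G => [p| |] [n| |] [F| |] [G| |]//= _ _ _ _ _ _ []//.
by move=> e; congr EFin; lra.
Qed.

(** The two events differ at most on [M = y], which has positive probability for only countably many
    [y]. *)
Lemma ae_eq_tail_probability (R : realType) d (T : measurableType d)
    (P : probability T R) (M : T -> R) (E : R -> set T) :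
  measurable_fun setT M -> (forall y, measurable (E y)) ->
  (forall y, M @^-1` `]y, +oo[ `<=` E y) ->
  (forall y, E y `<=` M @^-1` `[y, +oo[) ->
  {ae lebesgue_measure, forall y, P (E y) = P (M @^-1` `]y, +oo[)}.
Proof.
move=> mM mE ME EM.
have mMi (B : set R) : measurable B -> measurable (M @^-1` B).
  by move=> mB; rewrite -[_ @^-1` _]setTI; exact: mM.
pose X : {RV P >-> R} := HB.pack M (isMeasurableFun.Build _ _ _ _ M mM).
have cX := pmf_gt0_countable X.
exists [set r | 0 < pmf X r]; split.
- exact: countable_measurable.
- exact: countable_lebesgue_measure0.
move=> y /= nE; rewrite lt_neqAle pmf_ge0 andbT eq_sym; apply/eqP => p0.
apply: nE; apply/eqP; rewrite eq_le; apply/andP; split; last first.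
  by apply: le_measure; rewrite ?inE//; exact: mMi.
have mMy : measurable (M @^-1` `]y, +oo[) by apply: mMi; exact: measurable_itv.
have mM1 : measurable (M @^-1` [set y]) by apply: mMi; exact: measurable_set1.
have Py : P (M @^-1` [set y]) = 0%E.
  have : (fine (P (M @^-1` [set y])))%:E = 0%E by rewrite -[fine _]/(pmf X y)
    p0.
  by rewrite fineK// fin_num_measure.
apply: (@le_trans _ _ (P (M @^-1` [set y] `|` M @^-1` `]y, +oo[))).
  apply: le_measure; rewrite ?inE//; first exact: measurableU.
  by rewrite -preimage_setU setU1itv.
apply: (le_trans (measureU2 _ mM1 mMy)).
by rewrite -[leRHS]add0e; apply: leeD2r; rewrite -Py.
Qed.

(** * Signed measures on the half-line *)

Lemma smeas_variationE d (T : measurableType d) (R : realType)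
    (m : signed_measure T R) (A : set T) :
  smeas_variation m A = (smeas_pos m A + smeas_neg m A)%E.
Proof. exact: measure_addE. Qed.

Lemma locally_finite_parts (R : realType) (m : signed_measure R R) (x : R) :
  locally_finite_half_line m ->
  smeas_pos m `[0%R, x]%classic \is a fin_num /\
  smeas_neg m `[0%R, x]%classic \is a fin_num.
Proof.
move=> lf; have [x0|x0] := leP 0 x; last first.
  by rewrite set_itv_ge ?measure0// bnd_simp -ltNge.
have := lf _ x0.
rewrite smeas_variationE => lfx.
have p0 := measure_ge0 (smeas_pos m) `[0%R, x]%classic.
have n0 := measure_ge0 (smeas_neg m) `[0%R, x]%classic.
split; rewrite ge0_fin_numE//; apply: le_lt_trans lfx.
  by rewrite leeDl.
by rewrite leeDr.
Qed.

Lemma half_line_parts (R : realType) (m : signed_measure R R) :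
  on_half_line m ->
  smeas_pos m `]-oo, 0%R[%classic = 0%E /\ smeas_neg m `]-oo, 0%R[%classic =
    0%E.
Proof.
rewrite /on_half_line smeas_variationE => h.
have p0 := measure_ge0 (smeas_pos m) `]-oo, 0%R[%classic.
have n0 := measure_ge0 (smeas_neg m) `]-oo, 0%R[%classic.
by move/eqP: h; rewrite padde_eq0// => /andP[/eqP-> /eqP->].
Qed.

Lemma half_line_measure_le (R : realType) (mu : {measure set R -> \bar R})
    (x : R) :
  mu `]-oo, 0%R[%classic = 0%E -> 0 <= x ->
  (mu `]-oo, x]%classic <= mu `[0%R, x]%classic)%E.
Proof.
move=> mu0 x0.
rewrite (_ : `]-oo, x]%classic = `]-oo, 0%R[%classic `|` `[0%R, x]%classic).
  by rewrite -[leRHS]add0e -mu0; apply: measureU2; exact: measurable_itv.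
apply/seteqP; split => y /=; rewrite !in_itv/=.
  by move=> yx; case: (ltP y 0) => y0; [left|right].
by case=> [y0|/andP[]//]; rewrite (le_trans (ltW y0)).
Qed.

Lemma half_line_sigma_finite (R : realType) (mu : {measure set R -> \bar R}) :
  mu `]-oo, 0%R[%classic = 0%E ->
  (forall x : R, mu `[0%R, x]%classic \is a fin_num) -> sigma_finite setT mu.
Proof.
move=> mu0 muf; exists (fun n => `]-oo, n%:R]%classic).
  apply/seteqP; split => // x _; exists (Num.trunc x).+1 => //=.
  by rewrite in_itv/= ltW// truncnS_gt.
move=> n; split; first exact: measurable_itv.
apply: (le_lt_trans (half_line_measure_le mu0 (ler0n _ n))).
by rewrite ltey_eq muf.
Qed.

(** When the negative part is finite, [c] plus its total mass bounds the positive part of []-oo, n]]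
    uniformly in [n]; continuity from below concludes. *)
Lemma smeas_pos_finite (R : realType) (m : signed_measure R R) (c : R) :
  on_half_line m -> locally_finite_half_line m ->
  (forall x : R, 0 <= x -> (m `[0%R, x]%classic <= c%:E)%E) ->
  (smeas_pos m setT < +oo)%E.
Proof.
move=> hm lf mc; case: (smeas_finite m) => // nf.
have [p0 _] := half_line_parts hm.
have bnd n : (smeas_pos m `]-oo, n%:R]%classic <= c%:E + smeas_neg m setT)%E.
  have [pf nfin] := locally_finite_parts n%:R lf.
  apply: (le_trans (half_line_measure_le p0 (ler0n _ n))).
  have := mc n%:R (ler0n _ _); rewrite /smeas leeBlDr// => /le_trans; apply.
  by apply: leeD2l; apply: le_measure; rewrite ?inE//; exact: measurable_itv.
have : smeas_pos m (`]-oo, n%:R]%classic) @[n --> \oo] -->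
    smeas_pos m (\bigcup_n `]-oo, n%:R]%classic).
  apply: nondecreasing_cvg_mu.
  - by move=> n; exact: measurable_itv.
  - by apply: bigcupT_measurable => n; exact: measurable_itv.
  - by move=> a b ab; apply/subsetPset => x /=;
    rewrite !in_itv/= => /le_trans; apply; rewrite ler_nat.
rewrite (_ : \bigcup_n _ = setT); last first.
  apply/seteqP; split => // x _; exists (Num.trunc x).+1 => //=.
  by rewrite in_itv/= ltW// truncnS_gt.
move=> cv; apply: le_lt_trans (_ : c%:E + smeas_neg m setT < +oo)%E.
  by apply: (cvge_to_le cv); apply: nearW.
by rewrite lte_add_pinfty// ltry.
Qed.

(** [e] is half the gap between [c] and the mass at 0. Only the positive part needs continuity from
    above: the negative part of [[0, x]] is at least that of the point 0, and it is subtracted. *)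
Lemma smeas_right_continuous0 (R : realType) (m : signed_measure R R) (c : R) :
  locally_finite_half_line m -> (m [set 0%R] < c%:E)%E ->
  exists e r : R, [/\ 0 < e, 0 < r &
    forall x, 0 <= x <= r -> (m `[0%R, x]%classic <= (c - e)%:E)%E].
Proof.
move=> lf mc; have m00 (mu : {measure set R -> \bar R}) : mu [set 0%R] = mu
  `[0%R, 0%R]%classic.
  by rewrite set_itv1.
have [p0 n0] := locally_finite_parts 0 lf.
move: mc; rewrite /smeas !m00 -(fineK p0) -(fineK n0) -EFinB lte_fin.
set p := fine _; set n := fine _ => pnc.
pose e := (c - (p - n)) / 2.
have e0 : 0 < e by rewrite divr_gt0 // subr_gt0.
have : smeas_pos m (`[0%R, k.+1%:R^-1]%classic) @[k --> \oo] -->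
    smeas_pos m (\bigcap_k `[0%R, k.+1%:R^-1]%classic).
  apply: nonincreasing_cvg_mu.
  - by rewrite ltey_eq (locally_finite_parts _ lf).1.
  - by move=> k; exact: measurable_itv.
  - by apply: bigcapT_measurable => k; exact: measurable_itv.
  - move=> a b ab; apply/subsetPset => x /=;
    rewrite !in_itv/= => /andP[-> /le_trans]; apply.
    by rewrite lef_pV2 ?posrE// ler_nat.
rewrite (_ : \bigcap_k _ = `[0%R, 0%R]%classic); last first.
  apply/seteqP; split => x /=.
    move=> h; rewrite in_itv/=; have := h 0%N I;
      rewrite /= in_itv/= => /andP[-> _]/=.
    apply/ler_addgt0Pr => d d0; have [k] := @ltr_add_invr _ 0 d d0.
    rewrite !add0r => kd; have := h k I; rewrite /= in_itv/= => /andP[_ xk].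
    by apply: le_trans xk _; exact: ltW.
  by rewrite in_itv/= => /andP[x0 x1] k _ /=;
    rewrite in_itv/= x0/= (le_trans x1).
rewrite -(fineK p0) -/p => cv.
have pe : p < p + e by rewrite ltrDl.
have [k _ hk] := cv _ (@nbhs_open_ereal_lt _ p (fun=> p + e) pe).
exists e, k.+1%:R^-1; split => //.
move=> x /andP[x0 xk].
have [pf nf] := locally_finite_parts x lf.
rewrite leeBlDr//.
have /ltW := hk k (leqnn _); move=> /= pk.
have nn : (n%:E <= smeas_neg m `[0%R, x]%classic)%E.
  rewrite /n fineK//; apply: le_measure; rewrite ?inE;
    [exact: measurable_itv..|].
  by move=> y /=; rewrite !in_itv/= => /andP[-> /le_trans]; exact.
apply: (@le_trans _ _ (p + e)%:E).
  apply: le_trans pk; apply: le_measure; rewrite ?inE;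
    [exact: measurable_itv..|].
  by move=> y /=; rewrite !in_itv/= => /andP[-> /le_trans]; exact.
apply: (@le_trans _ _ ((c - e)%:E + n%:E)); last exact: leeD2l.
by rewrite -EFinD lee_fin /e; lra.
Qed.

Lemma measurable_cumulative (R : realType) (nu : {measure set R -> \bar R}) :
  (forall x : R, nu `[0%R, x]%classic \is a fin_num) ->
  measurable_fun (setT : set (measurableTypeR R))
    (fun x : R => nu `[0%R, x]%classic).
Proof.
move=> nuf.
apply: (eq_measurable_fun (fun x : R => (fine (nu `[0%R, x]%classic))%:E)).
  by move=> x _; rewrite fineK.
apply/measurable_EFinP; apply: nondecreasing_measurable => // x y xy.
rewrite fine_le// le_measure ?inE//; [exact: measurable_itv..|].
by move=> z /=; rewrite !in_itv/= => /andP[-> /le_trans]; exact.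
Qed.

(** The events [E y] are only required to lie between [M > y] and [M >= y], so that the identity
    applies both to the hitting events and, at time 0, to the deterministic events [y < b]. Tonelli
    handles each part of [m] with the tail [G] of [M], and [G] is exchanged for the probability of
    [E] almost everywhere. *)
Lemma signed_tail_identity (R : realType) d (T : measurableType d)
    (P : probability T R) (m : signed_measure R R) (M : T -> R)
    (E : R -> set T) :
  on_half_line m -> locally_finite_half_line m -> (smeas_pos m setT < +oo)%E ->
  measurable_fun setT M -> (\int[P]_w (Num.max (M w) 0)%:E < +oo)%E ->
  (forall y, measurable (E y)) ->
  (forall y, M @^-1` `]y, +oo[ `<=` E y) ->
  (forall y, E y `<=` M @^-1` `[y, +oo[) ->
  (forall y z, y <= z -> E z `<=` E y) ->
  (\int[lebesgue_measure]_(x in `[0%R, +oo[) (P (E x) * m `[0%R, x]%classic) =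
   smeas_integral m `[0%R, +oo[ (fun x => \int[P]_w (Num.max (M w - x)
     0)%:E))%E.
Proof.
move=> hm lf pf mM iM mE ME EM Ed.
pose G y : \bar R := P (M @^-1` `]y, +oo[).
have mMi y : measurable (M @^-1` `]y, +oo[).
  by rewrite -[_ @^-1` _]setTI; apply: mM => //; exact: measurable_itv.
pose X : {RV P >-> R} := HB.pack M (isMeasurableFun.Build _ _ _ _ M mM).
have mG : measurable_fun (setT : set (measurableTypeR R)) G by exact:
  (ccdf_measurable X).
have G0 y : (0 <= G y)%E by exact: measure_ge0.
have Gf y : G y \is a fin_num by rewrite fin_num_measure.
have vf x := locally_finite_parts x lf.
have [p0 n0] := half_line_parts hm.
have mp := measurable_cumulative (fun x => (vf x).1);
  have mn := measurable_cumulative (fun x => (vf x).2).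
rewrite /smeas_integral.
under [X in (X - _)%E]eq_integral do rewrite expectation_excess//.
under [X in (_ - X)%E]eq_integral do rewrite expectation_excess//.
rewrite !(tonelli_tail _ mG G0); first last.
- by apply: half_line_sigma_finite => // x; exact: (vf x).1.
- by apply: half_line_sigma_finite => // x; exact: (vf x).2.
(* Measurability in [x] comes from monotonicity: the events [E x] decrease in [x]. *)
have mPE : measurable_fun (setT : set (measurableTypeR R)) (fun x => P (E x)).
  apply: (eq_measurable_fun (fun x => (fine (P (E x)))%:E)).
    by move=> x _; rewrite fineK// fin_num_measure.
  apply/measurable_EFinP; apply: nonincreasing_measurable => // x y xy.
  rewrite fine_le ?fin_num_measure// le_measure ?inE//; exact: Ed.
have mGv (nu : {measure set R -> \bar R}) :
    measurable_fun (setT : set (measurableTypeR R)) (fun x : R => nu `[0%R,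
      x]%classic) ->
    measurable_fun (`[0%R, +oo[%classic : set (measurableTypeR R))
      (fun x => G x * nu `[0%R, x]%classic)%E.
  by move=> mnu; apply: measurable_funTS; apply: emeasurable_funM.
(* Bounding the positive part of [[0, x]] by its total mass leaves the integral of [G] over the
   half-line, which is the finite expectation of the positive part of [M]. *)
have finp : (\int[lebesgue_measure]_(x in `[0%R, +oo[)
    (G x * smeas_pos m `[0%R, x]%classic) < +oo)%E.
  apply: (@le_lt_trans _ _ (\int[lebesgue_measure]_(x in `[0%R, +oo[)
    (G x * smeas_pos m setT))%E).
    apply: ge0_le_integral => //.
    - by move=> x _; rewrite mule_ge0.
    - exact: mGv.
    - by apply: measurable_funTS; apply: emeasurable_funM.
    - move=> x _; apply: lee_wpmul2l => //.
      by apply: le_measure; rewrite ?inE//; exact: measurable_itv.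
  rewrite ge0_integralZr//; last exact: measurable_funTS.
  rewrite -expectation_excess//; apply: lte_mul_pinfty => //.
  - by apply: integral_ge0 => w _; rewrite lee_fin le_max lexx orbT.
  - rewrite ge0_fin_numE; first by under eq_integral do rewrite subr0.
    by apply: integral_ge0 => w _; rewrite lee_fin le_max lexx orbT.
rewrite -ge0_integralB//; first last.
- by move=> x _; rewrite fin_numM// (vf x).2.
- by move=> x _; rewrite fin_numM// (vf x).1.
- by move=> x _; rewrite mule_ge0.
- by move=> x _; rewrite mule_ge0.
- exact: mGv.
- exact: mGv.
transitivity (\int[lebesgue_measure]_(x in `[0%R, +oo[)
    (G x * m `[0%R, x]%classic))%E.
  apply: ae_eq_integral => //.
  - apply: measurable_funTS; apply: emeasurable_funM => //.
    exact: emeasurable_funB.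
  - apply: measurable_funTS; apply: emeasurable_funM => //.
    exact: emeasurable_funB.
  - have [N [mN N0 sub]] := ae_eq_tail_probability P mM mE ME EM.
    by exists N; split => // x ne; apply: sub => PE; apply: ne => _;
      rewrite /= PE.
apply: eq_integral => x _; rewrite /smeas muleBr//.
by rewrite fin_num_adde_defl// fin_numN (vf x).2.
Qed.

(** The integrand is at most [c] throughout and at most [c - e] on [[0, r']], an interval of
    positive length inside [[0, b[], so a margin of [e * r'] is gained. *)
Lemma smeas_integral_lt (R : realType) (m : signed_measure R R) (b c : R) :
  0 < b -> 0 < c -> locally_finite_half_line m -> (m [set 0%R] < c%:E)%E ->
  (forall x : R, 0 <= x -> (m `[0%R, x]%classic <= c%:E)%E) ->
  (\int[lebesgue_measure]_(x in `[0%R, b[) m `[0%R, x]%classic < (c * b)%:E)%E.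
Proof.
move=> b0 c0 lf m0 mc.
have [e [r [e0 r0 mr]]] := smeas_right_continuous0 lf m0.
have vf x := locally_finite_parts x lf.
have mp := measurable_cumulative (fun x => (vf x).1).
have mn := measurable_cumulative (fun x => (vf x).2).
pose r' := Num.min r (b / 2).
have r'0 : 0 < r' by rewrite lt_min r0 divr_gt0.
have [r'r r'b] : r' <= r /\ r' <= b / 2 by rewrite !ge_min !lexx orbT.
pose D : set (measurableTypeR R) := `[0%R, b[%classic.
have mD : measurable D by exact: measurable_itv.
have lD : (lebesgue_measure D = b%:E)%E.
  by rewrite /D lebesgue_measure_itv/= lte_fin b0 sube0.
have finD (nu : {measure set R -> \bar R}) :
    (forall x : R, nu `[0%R, x]%classic \is a fin_num) ->
    measurable_fun (setT : set (measurableTypeR R)) (fun x : R => nu `[0%R,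
      x]%classic) ->
    (\int[lebesgue_measure]_(x in D) nu `[0%R, x]%classic)%E \is a fin_num.
  move=> nuf mnu; rewrite ge0_fin_numE; last by apply: integral_ge0.
  apply: (@le_lt_trans _ _ (\int[lebesgue_measure]_(x in D) (cst (nu `[0%R,
    b]%classic)) x)%E).
    apply: ge0_le_integral => //; first exact: measurable_funTS.
    move=> x; rewrite /D /= in_itv/= => /andP[x0 xb].
    apply: le_measure; rewrite ?inE; [exact: measurable_itv..|].
    by move=> y /=; rewrite !in_itv/= => /andP[-> /le_trans]; apply; exact: ltW.
  by rewrite integral_cst//= lD -ge0_fin_numE ?mule_ge0 ?fin_numM// lee_fin ltW.
have pfin := finD _ (fun x => (vf x).1) mp.
have nfin := finD _ (fun x => (vf x).2) mn.
rewrite [X in (X < _)%E](_ : _ = (\int[lebesgue_measure]_(x in D)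
    smeas_pos m `[0%R, x]%classic - \int[lebesgue_measure]_(x in D)
    smeas_neg m `[0%R, x]%classic)%E); last first.
  apply: ge0_integralB => //.
  - exact: measurable_funTS.
  - exact: measurable_funTS.
  - by move=> x _; exact: (vf x).1.
  - by move=> x _; exact: (vf x).2.
  - by rewrite -ge0_fin_numE// integral_ge0.
pose I : set (measurableTypeR R) := `[0%R, r']%classic.
have mI : measurable I by exact: measurable_itv.
have mIe : measurable_fun D (fun x => (e * \1_I x)%:E).
  by apply: measurable_funTS; apply/measurable_EFinP; apply: measurable_funM.
(* The pointwise bound is rearranged so that both sides are nonnegative and monotonicity of the
   integral applies. *)
have : (\int[lebesgue_measure]_(x in D) (smeas_pos m `[0%R, x]%classic + (e *
  \1_I x)%:E) <=
    \int[lebesgue_measure]_(x in D) (cst c%:E x + smeas_neg m `[0%R,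
      x]%classic))%E.
  apply: ge0_le_integral => //.
  - by move=> x _; rewrite adde_ge0// lee_fin mulr_ge0// ltW.
  - by apply: emeasurable_funD => //; exact: measurable_funTS.
  - by apply: emeasurable_funD => //; exact: measurable_funTS.
  move=> x; rewrite /D /= in_itv/= => /andP[x0 xb].
  have := mc _ x0; have := mr x.
  rewrite /smeas -(fineK (vf x).1) -(fineK (vf x).2) -EFinB -!EFinD !lee_fin
    x0/=.
  set p := fine _; set n := fine _ => h1 h2; rewrite indicE.
  case: (boolP (x \in I)) => [|_]; last by rewrite mulr0; lra.
  rewrite inE /I /= in_itv/= => /andP[_ xr]; rewrite mulr1.
  have := h1 (le_trans xr r'r); lra.
rewrite !ge0_integralD//; [|by move=> x _; rewrite lee_fin ltW|
  exact: measurable_funTS|exact: measurable_funTS|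
  by move=> x _; rewrite lee_fin mulr_ge0// ltW].
rewrite integral_cst//= lD.
under [X in (_ + X <= _)%E]eq_integral do rewrite EFinM.
rewrite ge0_integralZl//; last 2 first.
- by apply/measurable_EFinP/measurable_indic.
- by rewrite lee_fin ltW.
rewrite integral_indic//=.
have -> : (lebesgue_measure (I `&` D) = r'%:E)%E.
  rewrite setIidl; last first.
    by move=> x /=; rewrite /I /D /= !in_itv/= => /andP[-> xr]; lra.
  by rewrite /I lebesgue_measure_itv/= lte_fin r'0 sube0.
rewrite -(fineK pfin) -(fineK nfin) -EFinB -!EFinM -!EFinD lee_fin lte_fin.
have : 0 < e * r' by rewrite mulr_gt0.
lra.
Qed.

(** * Equivalence of the hitting-time equation and the Skorokhod equation *)

Theorem proposition1p12 (R : realType) (d : measure_display)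
    (T : measurableType d) (P : probability T R) (W : R -> T -> R)
    (alpha : R) (m : signed_measure R R) (l : R -> R) :
  0 < alpha ->
  standard_brownian_motion P W ->
  on_half_line m ->
  locally_finite_half_line m ->
  (m [set 0%R] < (alpha^-1)%:E)%E ->
  (forall x : R, 0 <= x -> (m `[0%R, x]%classic <= (alpha^-1)%:E)%E) ->
  (forall c : R, 0 < c ->
    (\int[smeas_variation m]_(x in `[0%R, +oo[) (expR (- c * x ^+ 2))%:E < +oo)%E) ->
  {within `[0, +oo[, continuous l} ->
  let v (x : R) : \bar R := m `[0, x]%classic in
  let tau (x : R) (w : T) : \bar R :=
    hitting_time (fun t => x + W t w - alpha * l t) in
  (forall t : R, 0 <= t ->
    ((l t)%:E = \int[lebesgue_measure]_(x in `[0%R, +oo[)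
                  (P [set w | (tau x w <= t%:E)%E] * v x))%E)
  <->
  (exists X L : R -> R -> T -> R,
    (forall (x : R) (w : T), 0 <= x ->
       skorokhod_problem (fun t => x + W t w - alpha * l t)
         (fun t => X x t w) (fun t => L x t w)) /\
    (forall t : R, 0 <= t ->
       (l t)%:E = smeas_integral m `[0%R, +oo[%classic (fun x => 'E_P[L x t])%E)).
Proof.
move=> a0 BM hm lf m0 mle _ cl v tau.
(* With [G = alpha * l - W], frozen at its initial value for negative times, the Skorokhod datum is
   [x - G] and [M t] below is the running maximum of [G]. *)
pose G (s : R) (w : T) : R := alpha * l (Num.max s 0) - W (Num.max s 0) w.
have cW w : continuous (fun s : R => W (Num.max s 0) w).
  by apply: (@continuous_comp_max0 _ (W ^~ w)); exact: (brownian_continuous BM).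
have cL : continuous (fun s : R => l (Num.max s 0)) by exact:
  continuous_comp_max0.
have cG w : continuous (G ^~ w).
  move=> s; apply: cvgB; last exact: cW.
  by apply: cvgM; [exact: cvg_cst|exact: cL].
have mG s : 0 <= s -> measurable_fun setT (G s).
  move=> s0; apply: measurable_funB => //.
  by apply: (brownian_measurable BM); rewrite le_max lexx orbT.
have fE x w s : 0 <= s -> x + W s w - alpha * l s = x - G s w.
  by move=> s0; rewrite /G max_l//; ring.
pose M (t : R) (w : T) : R := runmax (G ^~ w) t.
pose E (t x : R) : set T := [set w | (tau x w <= t%:E)%E].
have mM t : 0 <= t -> measurable_fun setT (M t).
  by move=> t0; exact: measurable_runmax.
have mE t : 0 <= t -> forall x, measurable (E t x).
  move=> t0 x.
  apply: (@measurable_hitting_time_le _ _ _ G (fun s w => x + W s w - alpha * l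
    s) x) => //.
  by move=> s w; exact: fE.
have ME t : 0 <= t -> forall x, M t @^-1` `]x, +oo[ `<=` E t x.
  move=> t0 x w /=; rewrite in_itv/= andbT.
  exact: (hitting_time_le_runmax (cG w) (fE x w) t0).
have EM t : 0 <= t -> forall x, E t x `<=` M t @^-1` `[x, +oo[.
  move=> t0 x w /=; rewrite in_itv/= andbT.
  exact: (runmax_hitting_time_le (cG w) (fE x w) t0).
have Ed t x y : x <= y -> E t y `<=` E t x.
  move=> xy w; rewrite /E /= => /(le_trans _); apply.
  apply: ereal_inf_le_tmp => _ [s /= [s0 ys] <-]; exists s => //=.
  by split => //; apply: le_trans ys; lra.
have pf := smeas_pos_finite hm lf mle.
have iM t : 0 <= t -> (\int[P]_w (Num.max (M t w) 0)%:E < +oo)%E.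
  move=> t0; have [S [mS S0 WS iS]] := brownian_dominated BM t0.
  pose C := Num.max (alpha * runmax (fun s : R => l (Num.max s 0)) t) 0.
  have C0 : 0 <= C by rewrite le_max lexx orbT.
  apply: (@le_lt_trans _ _ (\int[P]_w (cst C%:E w + S w))%E).
    apply: ge0_le_integral => //.
    - by move=> w _; rewrite lee_fin le_max lexx orbT.
    - by apply/measurable_EFinP; apply: measurable_maxr => //; exact: mM.
    - exact: emeasurable_funD.
    move=> w _; rewrite EFin_max ge_max adde_ge0 ?lee_fin// andbT.
    have [s st [Ms _]] := runmax_attained (cG w) t0.
    rewrite [M t w]Ms.
    have /andP[s0 _] := st.
    rewrite /G EFinB max_l//; apply: leeD.
      rewrite lee_fin /C le_max; apply/orP; left; apply: ler_wpM2l;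
        first exact: ltW.
      have := runmax_ge cL st; by rewrite /= max_l.
    apply: le_trans (WS w _ st); rewrite lee_fin -normrN; exact: ler_norm.
  rewrite ge0_integralD//.
  by rewrite integral_cst//= probability_setT mule1 lte_add_pinfty// ltry.
(* Equates the right-hand side of (a) with that of (b), the local time being replaced by the excess
   of [M t] over [x]. *)
have ident t : 0 <= t -> (\int[lebesgue_measure]_(x in `[0%R, +oo[) (P (E t x)
  * v x) =
    smeas_integral m `[0%R, +oo[ (fun x => \int[P]_w (Num.max (M t w - x)
      0)%:E))%E.
  move=> t0; apply: signed_tail_identity => //.
  - exact: mM.
  - exact: iM.
  - exact: mE.
  - exact: ME.
  - exact: EM.
  - exact: Ed.
have seq_integral (f g : R -> \bar R) : (forall x, 0 <= x -> f x = g x) ->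
    smeas_integral m `[0%R, +oo[ f = smeas_integral m `[0%R, +oo[ g.
  move=> fg; rewrite /smeas_integral; congr (_ - _)%E; apply: eq_integral => x;
    by rewrite inE/= in_itv/= andbT; exact: fg.
split=> [la|[X [L [sk lb]]] t t0]; last first.
  rewrite (lb t t0) ident//; apply: seq_integral => x x0.
  rewrite unlock; apply: eq_integral => w _; congr EFin.
  exact: (skorokhod_unique (cG w) (fE x w) (sk x w x0) t0).
(* Needed for the datum to start at a nonnegative value for every [x >= 0], including [x = 0]. *)
have l0 : l 0 <= 0.
  rewrite leNgt; apply/negP => l0; pose b := alpha * l 0.
  have b0 : 0 < b by rewrite mulr_gt0.
  have M0 w : M 0 w = b.
    by rewrite /M runmax0 /G maxxx (brownian_start BM) subr0.
  (* Since [M 0] is the constant [b], these events also satisfy the tail identity. They avoid the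
     law of the hitting time at time 0, which is delicate for [x = b], and turn the equation at
     [t = 0] into [l 0] being the integral of [v] over [[0, b[]. *)
  pose E' (x : R) : set T := [set _ | x < b].
  have PE' x : P (E' x) = if x < b then 1%E else 0%E.
    case: ifPn => xb; [rewrite -(probability_setT P)|rewrite -(measure0 P)];
      congr (P _); apply/seteqP; split => // w; rewrite /E' /= ?xb//.
    by rewrite (negbTE xb).
  have E'E : (\int[lebesgue_measure]_(x in `[0%R, +oo[) (P (E' x) * v x) =
      smeas_integral m `[0%R, +oo[ (fun x => \int[P]_w (Num.max (M 0%R w - x)
        0)%:E))%E.
    apply: signed_tail_identity => //.
    - exact: mM.
    - exact: iM.
    - move=> y; rewrite /E'; case: (y < b).
        by rewrite (_ : mkset _ = setT)//; apply/seteqP; split.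
      by rewrite (_ : mkset _ = set0)//; apply/seteqP; split.
    - by move=> y w /=; rewrite in_itv/= andbT M0.
    - by move=> y w /=; rewrite in_itv/= andbT M0 => /ltW.
    - by move=> y z yz w; rewrite /E' /=; exact: le_lt_trans.
  have := la 0 (lexx 0); rewrite ident// -E'E => l0E.
  have ainv0 : 0 < alpha^-1 by rewrite invr_gt0.
  have := smeas_integral_lt b0 ainv0 lf m0 mle.
  (* The strict upper bound [b / alpha] is [l 0] itself, a contradiction. *)
  rewrite /b mulKf ?gt_eqF// l0E -/b => /lt_eqF/eqP; apply.
  rewrite [LHS]integral_mkcond [RHS]integral_mkcond; apply: eq_integral => x _.
  rewrite !patchE !mem_setE !in_itv/= andbT.
  have [x0|//] := boolP (0 <= x).
  rewrite PE'; case: (x < b) => /=; first by rewrite mul1e.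
  by rewrite mul0e.
pose L (x t : R) (w : T) : R := Num.max (M (Num.max t 0) w - x) 0.
exists (fun x t w => x - G (Num.max t 0) w + L x t w), L; split.
  move=> x w x0; apply: (skorokhod_continuous (cG w)); last exact: fE.
  rewrite /G maxxx (brownian_start BM) subr0; apply: le_trans x0.
  by rewrite pmulr_rle0.
move=> t t0; rewrite (la t t0) ident//; apply: seq_integral => x x0.
by rewrite unlock; apply: eq_integral => w _; rewrite /L (max_l t0).
Qed.
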